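(* Let $(\Omega,d,\mu)$ be a doubling metric measure space with doubling constant $C_\mu$ and upper dimension $Q=\log_2C_\mu$. The following statements are equivalent: (1) The non-collapsing condition holds: there is a constant $b>0$ with $\inf_{x\in\Omega}\mu(B(x,1))=b$. (2) Let $0<\alpha\le1$, $0<q\le\infty$ and $0<s<1$. Then there is a positive constant $C=C(C_\mu,\alpha,q)$ such that for any r.i. space $X$ on $\Omega$ and every $f\in L^\alpha(\Omega)+L^\infty(\Omega)$, $$\left(\int_0^1\left(O(|f|^\alpha,t)^{1/\alpha}\,\frac{\phi_{X^{(\alpha)}}(t)}{t^{s/Q}}\right)^q\frac{dt}t\right)^{1/q}\le C\left(\|f\|_{\dot B^s_{X^{(\alpha)},q}}+\|f\|_{L^\alpha+L^\infty}\right)$$ (with the usual modification when $q=\infty$).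
   Context: Doubling metric measure space: $(\Omega,d)$ is a metric space, $B(x,r)=\{y\in\Omega: d(x,y)<r\}$, and $\mu$ is a Borel measure with $0<\mu(B)<\infty$ for every ball $B$, such that for some $C>1$ one has $\mu(B(x,2r))\le C\mu(B(x,r))$ for all $x\in\Omega$, $r>0$; the smallest such $C$ is the doubling constant $C_\mu$, and $Q=\log_2C_\mu$ is the upper dimension. Standing assumptions: $\mu(\Omega)=\infty$ and $\mu(\{x\})=0$ for all $x\in\Omega$. Rearrangements: for measurable $f:\Omega\to\mathbb R$, $\mu_f(t)=\mu\{x:|f(x)|>t\}$, $f^*(t)=\inf\{\sigma\ge0:\mu_f(\sigma)\le t\}$, $f^{**}(t)=\frac1t\int_0^tf^*(\sigma)\,d\sigma$. For $0<\alpha\le1$, $O(|f|^\alpha,t)=(|f|^\alpha)^{**}(t)-(|f|^\alpha)^*(t)$. $\|f\|_{L^\alpha+L^\infty}$ is the usual sum quasi-norm $\inf\{\|f_0\|_{L^\alpha}+\|f_1\|_{L^\infty}:f=f_0+f_1\}$. A quasi-Banach rearrangement invariant space (q.r.i. space) $X$ on $\Omega$ is a subspace of $L^0(\Omega)$ (measurable functions with the topology of local convergence in measure) with a quasi-norm $\|\cdot\|_X$ such that: $X$ is complete; $X\hookrightarrow L^0$ is continuous; $\chi_E\in X$ whenever $\mu(E)<\infty$; if $0\le f_n\nearrow f$ a.e. and $f\in X$ then $\|f_n\|_X\nearrow\|f\|_X$; and $\|f\|_X=\|g\|_X$ whenever $f^*=g^*$. It is an r.i. space if $\|\cdot\|_X$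 is a norm. For $r>0$, the $r$-convexification is $X^{(r)}=\{f:|f|^r\in X\}$ with $\|f\|_{X^{(r)}}=\||f|^r\|_X^{1/r}$. The fundamental function is $\phi_X(t)=\|\chi_E\|_X$ for any measurable $E$ with $\mu(E)=t$; $\phi_{X^{(r)}}=\phi_X^{1/r}$. Besov seminorm: for $f\in L^\alpha(\Omega)+L^\infty(\Omega)$ and $r>0$ put $$\nabla_r^\alpha f(x)=\left(\frac1{\mu(B(x,r))}\int_{B(x,r)}|f(x)-f(y)|^\alpha d\mu(y)\right)^{1/\alpha},\qquad E_{X^{(\alpha)}}(f,r)=\|\nabla_r^\alpha f\|_{X^{(\alpha)}},$$ and $\|f\|_{\dot B^s_{X^{(\alpha)},q}}=\left(\int_0^\infty\left(r^{-s}E_{X^{(\alpha)}}(f,r)\right)^q\frac{dr}r\right)^{1/q}$ (supremum over $r>0$ if $q=\infty$); it may be $+\infty$.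
   Formalization: In (2), X ranges over r.i. spaces normalized by φ_X(1)=1 (otherwise rescaling the norm of X makes (1)⇒(2) false), and C, independent of s, X and f, may depend on the fixed space Ω (it must depend on b), not only on C_μ, α, q. *)

(* Defs.v *)
(* MathComp-Analysis *)
From HB Require Import structures.
From mathcomp Require Export all_boot all_order all_algebra.
From mathcomp Require Export all_classical all_reals all_analysis.

Set Implicit Arguments.
Unset Strict Implicit.
Unset Printing Implicit Defensive.

Import Order.TTheory GRing.Theory Num.Theory.
Import numFieldNormedType.Exports.

Local Open Scope classical_set_scope.
Local Open Scope ring_scope.

(* A metric space carrying a sigma-algebra; the two are related only by
   [borel_space] below. *)
#[short(type="metricMeasurableType")]
HB.structure Definition MetricMeasurable (R : numDomainType)
    (d : measure_display) :=
  {T of Measurable d T & Metric R T}.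

Definition borel_space (R : realType) (d : measure_display)
    (T : metricMeasurableType R d) : Prop :=
  (@measurable d T : set (set T)) = <<s open >>.

Section doubling.
Context (R : realType) (d : measure_display) (T : metricMeasurableType R d).
Variable mu : {measure set T -> \bar R}.
Local Open Scope ereal_scope.

Definition doubling_with (C : R) : Prop :=
  forall (x : T) (r : R), (0 < r)%R ->
    mu (ball x (2 * r)%R) <= C%:E * mu (ball x r).

Definition doubling_constants : set R := [set C | (1 < C)%R /\ doubling_with C].

Definition doubling_measure : Prop :=
  (forall (x : T) (r : R), (0 < r)%R -> 0 < mu (ball x r) < +oo) /\
  doubling_constants !=set0.

Definition doubling_constant : R := inf doubling_constants.

Definition upper_dim : R := (ln doubling_constant / ln 2)%R.

Definition noncollapsing : Prop :=
  exists2 b : R, (0 < b)%R &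
    ereal_inf [set mu (ball x 1%R) | x in [set: T]] = b%:E.

End doubling.

Section rearrangement.
Context (R : realType) (d : measure_display) (T : measurableType d).
Variable mu : {measure set T -> \bar R}.
Local Open Scope ereal_scope.
Implicit Types f g : T -> R.

Definition distrib_fun f (t : R) : \bar R := mu [set x | (t < `|f x|)%R].

(* f^*(t); the value is +oo when no level qualifies. *)
Definition rearr f (t : R) : \bar R :=
  ereal_inf [set s%:E | s in [set s : R | (0 <= s)%R /\
                                          distrib_fun f s <= t%:E]].

(* f^**(t) *)
Definition rearr_avg f (t : R) : \bar R :=
  (t^-1)%:E * \int[lebesgue_measure]_(s in `]0%R, t[) rearr f s.

Definition oscill f (t : R) : \bar R := rearr_avg f t - rearr f t.

Definition pow_abs (a : R) f : T -> R := fun x => (`|f x| `^ a)%R.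

(* The decompositions f = f0 + f1 with f0 in L^a and f1 in L^oo. *)
Definition sum_decomp (a : R) f : set ((T -> R) * (T -> R)) :=
  [set h | [/\ measurable_fun setT h.1, measurable_fun setT h.2,
               finite_norm mu a%:E h.1, finite_norm mu +oo h.2 &
               forall x, f x = (h.1 x + h.2 x)%R]].

Definition sum_space (a : R) : set (T -> R) :=
  [set f | sum_decomp a f !=set0].

Definition sum_norm (a : R) f : \bar R :=
  ereal_inf [set 'N[mu]_a%:E[EFin \o h.1] + 'N[mu]_+oo[EFin \o h.2]
            | h in sum_decomp a f].

End rearrangement.

(* Elements of L^0 are represented by functions rather than by classes modulo
   a.e. equality; [qri_null] says that the quasi-norm separates exactly these
   classes, and together with [qri_rearr] it makes the space saturated for
   a.e. equality. *)
Record qri_space (R : realType) (d : measure_display) (T : measurableType d)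
    (mu : {measure set T -> \bar R}) := QriSpace {
  qri_car : set (T -> R) ;
  qri_norm : (T -> R) -> R ;
  qri_meas : forall f, qri_car f -> measurable_fun setT f ;
  qri_add : forall f g, qri_car f -> qri_car g -> qri_car (f \+ g) ;
  qri_scale : forall (c : R) f, qri_car f -> qri_car (fun x => c * f x) ;
  qri_ge0 : forall f, qri_car f -> 0 <= qri_norm f ;
  qri_null : forall f, qri_car f ->
    (qri_norm f = 0 <-> {ae mu, forall x, f x = 0}) ;
  qri_homo : forall (c : R) f, qri_car f ->
    qri_norm (fun x => c * f x) = `|c| * qri_norm f ;
  qri_quasi : exists2 K : R, 1 <= K & forall f g, qri_car f -> qri_car g ->
    qri_norm (f \+ g) <= K * (qri_norm f + qri_norm g) ;
  qri_complete : forall u : nat -> T -> R, (forall n, qri_car (u n)) ->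
    (forall e : R, 0 < e -> exists N : nat, forall m n : nat,
       (N <= m)%N -> (N <= n)%N -> qri_norm (u m \- u n) < e) ->
    exists2 f, qri_car f & qri_norm (u n \- f) @[n --> \oo] --> (0 : R) ;
  (* continuity of the inclusion into L^0, whose topology is that of
     convergence in measure on sets of finite measure *)
  qri_embed : forall f, qri_car f ->
    forall (E : set T) (e del : R), measurable E -> (mu E < +oo)%E ->
    0 < e -> 0 < del -> exists2 eta : R, 0 < eta &
      forall g, qri_car g -> qri_norm (g \- f) < eta ->
        (mu (E `&` [set x | (e < `|g x - f x|)%R]) < del%:E)%E ;
  qri_indic : forall E : set T, measurable E -> (mu E < +oo)%E ->
    qri_car \1_E ;
  qri_fatou : forall (u : nat -> T -> R) f,
    (forall n, measurable_fun setT (u n)) -> qri_car f ->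
    {ae mu, forall x, (forall n, 0 <= u n x <= u n.+1 x) /\
                      u n x @[n --> \oo] --> f x} ->
    [/\ forall n, qri_car (u n),
        forall n, qri_norm (u n) <= qri_norm (u n.+1) &
        qri_norm (u n) @[n --> \oo] --> qri_norm f] ;
  qri_rearr : forall f g, qri_car f -> measurable_fun setT g ->
    (forall t : R, 0 <= t -> rearr mu f t = rearr mu g t) ->
    qri_car g /\ qri_norm f = qri_norm g
}.

Section spaces.
Context (R : realType) (d : measure_display) (T : measurableType d).
Variables (mu : {measure set T -> \bar R}) (X : qri_space mu).
Local Open Scope ereal_scope.

Definition is_ri : Prop := forall f g, qri_car X f -> qri_car X g ->
  (qri_norm X (f \+ g) <= qri_norm X f + qri_norm X g)%R.

(* The quasi-norm of X, extended by +oo outside X. *)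
Definition xnorm (f : T -> R) : \bar R :=
  if pselect (qri_car X f) then (qri_norm X f)%:E else +oo.

(* The quasi-norm of the r-convexification X^(r), extended in the same way. *)
Definition convex_norm (r : R) (f : T -> R) : \bar R :=
  xnorm (pow_abs r f) `^ r^-1.

(* The fundamental function phi_N of N; for the quasi-norm of a q.r.i. space
   the set below has at most one element. *)
Definition fundamental (N : (T -> R) -> \bar R) (t : R) : \bar R :=
  xget 0 [set N \1_E | E in [set E : set T | measurable E /\ mu E = t%:E]].

(* The convention phi_X(1) = 1.  The axioms of a q.r.i. space are insensitive
   to multiplying the norm by a positive constant, so an estimate with a
   constant uniform in X that adds to X-norms a quantity not depending on X
   needs it: otherwise that quantity could be scaled away. *)
Definition normalized : Prop := fundamental xnorm 1 = 1.

End spaces.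

(* The L^q(I, dt/t) quasi-norm of a nonnegative g, a supremum if q = +oo. *)
Definition Lq_dt_t (R : realType) (q : \bar R) (I : set R) (g : R -> \bar R)
    : \bar R :=
  match q with
  | q'%:E =>
      ((\int[lebesgue_measure]_(t in I) (g t `^ q' * (t^-1)%:E)) `^ q'^-1)%E
  | _ => ereal_sup [set g t | t in I]
  end.

Section besov.
Context (R : realType) (d : measure_display) (T : metricMeasurableType R d).
Variables (mu : {measure set T -> \bar R}) (X : qri_space mu).

(* Real-valued integral and measure: both are finite for r > 0 and f in
   L^a + L^oo. *)
Definition nabla (a r : R) (f : T -> R) (x : T) : R :=
  ((fine (mu (ball x r)))^-1 *
   \int[mu]_(y in ball x r) (`|f x - f y| `^ a)) `^ a^-1.

Definition modulus (a : R) (f : T -> R) (r : R) : \bar R :=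
  convex_norm X a (nabla a r f).

Definition besov_seminorm (a s : R) (q : \bar R) (f : T -> R) : \bar R :=
  Lq_dt_t q `]0, +oo[ (fun r => ((r `^ (- s))%:E * modulus a f r)%E).

Definition oscill_norm (a s : R) (q : \bar R) (f : T -> R) : \bar R :=
  Lq_dt_t q `]0, 1[
    (fun t => (oscill mu (pow_abs a f) t `^ a^-1
               * fundamental mu (convex_norm X a) t
               * ((t `^ (s / upper_dim mu))^-1)%:E)%E).

End besov.

(* Main.v *)
Require Import Defs.
From mathcomp Require Import measurable_realfun ess_sup_inf ring lra.

(** From noncollapsing to the estimate.  Write g = |f|^alpha, c = g*(t) and
    h = (nabla_r f)^alpha.  If every ball of radius r has measure at least 2t,
    then at least half of B(x, r) lies in the set where g <= c, and
    ||a|^alpha - |b|^alpha| <= |a - b|^alpha gives (g - c)_+ <= 2h pointwise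
    ([nabla_lower]).  Up to the factor t, the oscillation O(g, t) is the integral
    of the rearrangement of (g - c)_+ over (0, t).  In an r.i. space the average
    of a rearrangement over (0, t), times phi(t), is at most the norm
    ([ri_int_rearr]), so that
      O(g, t)^(1/alpha) phi(t) <= 2^(1/alpha) E(f, r)     ([oscill_modulus]).

    Doubling and noncollapsing give mu(B(x, 2^-j)) >= b C^-j for the doubling
    constant C = 2^Q.  With t0 = b/2, the bound above then holds for all t in
    [t0 C^-(j+1), t0 C^-j) and all r in [2^-j, 2^(1-j)), and on such a pair of
    blocks t^(-s/Q) is at most a constant times r^-s.  Both blocks have bounded
    logarithmic length, so that summing over j compares the two L^q(dt/t) norms
    ([Lq_compare]).  The remaining t in [t0, 1) are controlled by the norm of f
    in L^alpha + L^oo alone, because phi(t) <= phi(1) = 1 ([oscill_crude]).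

    Behind [ri_int_rearr] is the fact that mu has no atoms in the strong sense
    that every measurable set contains subsets of all smaller measures
    ([doubling_divisible]).  The superlevel sets of a function can then be
    completed to a chain of sets of measures tau, 2 tau, 3 tau, ..., whose
    successive differences are slices of equal measure on which the function
    dominates the values of its rearrangement ([quantile_slices]).  Permuting
    these values cyclically among the slices does not change the norm, and the
    average over all cyclic permutations is constant ([ri_average]).

    From the estimate to noncollapsing.  Take X = L^oo, alpha = 1, q = oo and the
    cutoff f(y) = max(0, 1 - d(x0, y)).  Its Besov seminorm and its norm in
    L^1 + L^oo are at most 1, whereas at t = m := mu(B(x0, 1)) the oscillation is
    at least 1/(2C): f* vanishes at m and is at least 1/2 on (0, mu(B(x0, 1/2))).
    If m < 1, the estimate bounds m^(-s/Q), hence bounds m from below, uniformly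
    in x0 ([estimate_noncollapsing]). *)

Set Implicit Arguments.
Unset Strict Implicit.
Unset Printing Implicit Defensive.
Import Order.TTheory GRing.Theory Num.Theory.
Import numFieldNormedType.Exports.
Local Open Scope classical_set_scope.
Local Open Scope ring_scope.

(** * Subsets of prescribed measure *)

(** The conclusion of Sierpinski's theorem on atomless measures.  It is the form
    in which the absence of atoms is used. *)
Definition divisible (R : realType) (d : measure_display) (T : measurableType d)
    (mu : {measure set T -> \bar R}) : Prop :=
  forall (A : set T) (m : R), measurable A -> 0 <= m -> (m%:E <= mu A)%E ->
  exists B, [/\ measurable B, B `<=` A & mu B = m%:E].

Section atomless_doubling.
Context {R : realType} {d : measure_display} {T : metricMeasurableType R d}.
Variable mu : {measure set T -> \bar R}.
Hypothesis T_borel : borel_space T.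

Lemma open_ball_metric (x : T) (r : R) : open (ball x r).
Proof.
rewrite openE => y; rewrite ballEmdist/= => xy.
apply/nbhs_ballP; exists (r - mdist x y) => /=; first by rewrite subr_gt0.
move=> z; rewrite !ballEmdist/= => yz.
by rewrite (le_lt_trans (metric_triangle x y z))// -ltrBrDl.
Qed.

Lemma measurable_open (A : set T) : open A -> measurable A.
Proof. by move=> oA; rewrite T_borel; exact: sub_sigma_algebra. Qed.

Lemma measurable_mball (x : T) (r : R) : measurable (ball x r).
Proof. exact/measurable_open/open_ball_metric. Qed.

Lemma sub_ball (x y : T) (r s : R) : mdist x y + r <= s ->
  ball y r `<=` ball x s.
Proof.
move=> h z; rewrite !ballEmdist/= => yz.
by apply: le_lt_trans (metric_triangle x y z) _; rewrite (lt_le_trans _ h)// ltrD2l.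
Qed.

Lemma le_measure_ball (x y : T) (r s : R) : mdist x y + r <= s ->
  (mu (ball y r) <= mu (ball x s))%E.
Proof.
by move=> h; apply: le_measure; rewrite ?inE; [exact: measurable_mball..|exact: sub_ball].
Qed.

Lemma le_measure_ballr (x : T) (r s : R) : r <= s ->
  (mu (ball x r) <= mu (ball x s))%E.
Proof. by move=> h; apply: le_measure_ball; rewrite mdistxx add0r. Qed.

Lemma doubling_iter (C : R) : 0 <= C -> doubling_with mu C ->
  forall n (x : T) (r : R), 0 < r ->
  (mu (ball x (2 ^+ n * r)) <= (C ^+ n)%:E * mu (ball x r))%E.
Proof.
move=> C0 dC; elim=> [|n IH] x r r0; first by rewrite !expr0 mul1r mul1e.
rewrite exprS -mulrA; apply: le_trans (dC x _ _) _; first by rewrite mulr_gt0// exprn_gt0.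
by rewrite exprS EFinM -muleA lee_wpmul2l ?lee_fin// IH.
Qed.

Hypothesis mu_doubling : doubling_measure mu.

Lemma mu_ball_gt0 (x : T) (r : R) : 0 < r -> (0 < mu (ball x r))%E.
Proof. by move=> r0; have [/(_ x r r0)/andP[]] := mu_doubling. Qed.

Lemma mu_ball_lty (x : T) (r : R) : 0 < r -> (mu (ball x r) < +oo)%E.
Proof. by move=> r0; have [/(_ x r r0)/andP[]] := mu_doubling. Qed.

Lemma mu_ball_fin (x : T) (r : R) : 0 < r -> mu (ball x r) \is a fin_num.
Proof. by move=> r0; rewrite ge0_fin_numE// mu_ball_lty. Qed.

(** Otherwise there are arbitrarily long eps-separated sequences in the ball.  The
    balls of radius eps / 2 around their terms are disjoint, lie in one ball of
    finite measure, and doubling bounds their measures from below uniformly. *)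
Lemma finite_net (x0 : T) (rho eps : R) : 0 < rho -> 0 < eps ->
  exists s : seq T, forall x, ball x0 rho x ->
    exists2 y, y \in s & ball y eps x.
Proof.
move=> rho0 eps0; apply: contrapT => nonet.
have e20 : 0 < eps / 2 by rewrite divr_gt0.
pose sep := fun a b : T => eps <= mdist a b.
have seps n : exists s : seq T,
    [/\ size s = n, all (fun y => mdist x0 y < rho) s & pairwise sep s].
  elim: n => [|n [s [ss sb sp]]]; first by exists [::].
  have [y yb ys] : exists2 y, ball x0 rho y & all (sep y) s.
    apply: contrapT => h; apply: nonet; exists s => x xb.
    apply: contrapT => nx; apply: h; exists x => //; apply/allP => y ys.
    rewrite /sep leNgt; apply/negP => xy; apply: nx; exists y => //.
    by rewrite ballEmdist/= metric_sym.
  by exists (y :: s); rewrite /= ss sb ys sp; rewrite ballEmdist/= in yb; rewrite yb.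
have [_ [C [C1 dC]]] := mu_doubling.
have C0 : 0 < C := lt_trans ltr01 C1.
have [k hk] : exists k, 2 * rho <= 2 ^+ k * (eps / 2).
  exists (Num.truncn (2 * rho / (eps / 2))).+1; rewrite -ler_pdivrMr//.
  apply: le_trans (ltW (truncnS_gt _)) _.
  by rewrite -natrX ler_nat ltnW// ltn_expl.
pose del := fine (mu (ball x0 rho)) / C ^+ k.
have del0 : 0 < del.
  by rewrite divr_gt0 ?exprn_gt0// fine_gt0// mu_ball_gt0//= mu_ball_lty.
have ldel y : mdist x0 y < rho -> (del%:E <= mu (ball y (eps / 2)))%E.
  move=> y0; rewrite -(@fineK _ (mu (ball y (eps / 2)))) ?mu_ball_fin// lee_fin.
  rewrite ler_pdivrMr ?exprn_gt0// -lee_fin fineK ?mu_ball_fin//.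
  rewrite EFinM fineK ?mu_ball_fin// muleC.
  apply: (le_trans _ (doubling_iter (ltW C0) dC k y e20)).
  apply: le_measure_ball; apply: (le_trans _ hk).
  by rewrite mulr2n mulrDl mul1r lerD2r metric_sym ltW.
have lsum s : all (fun y => mdist x0 y < rho) s -> pairwise sep s ->
   (((size s)%:R * del)%:E <= mu (\big[setU/set0]_(y <- s) ball y (eps / 2)%R))%E.
  elim: s => [|y s IH]; first by rewrite mul0r big_nil measure0.
  move=> /=/andP[yb sb] /andP[ys sp]; rewrite big_cons measureU//.
  - by rewrite mulrC -addn1 natrD mulrDr mulr1 addrC EFinD leeD ?ldel// mulrC IH.
  - exact: measurable_mball.
  - by apply: bigsetU_measurable => *; exact: measurable_mball.
  - rewrite -subset0 => z [zy]; rewrite -bigcup_seq => -[u /= us zu].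
    move/allP : ys => /(_ u us); rewrite /sep leNgt => /negP; apply.
    move: zy zu; rewrite !ballEmdist/= => zy zu.
    rewrite (le_lt_trans (metric_triangle y z u))// (splitr eps) ltrD//.
    by rewrite metric_sym.
have [n hn] : exists n : nat, fine (mu (ball x0 (rho + eps))) < n%:R * del.
  exists (Num.truncn (fine (mu (ball x0 (rho + eps))) / del)).+1.
  by rewrite -ltr_pdivrMr// truncnS_gt.
have [s [ss sb sp]] := seps n.
have := lsum _ sb sp; rewrite ss; apply/negP; rewrite -ltNge.
apply: (@le_lt_trans _ _ (mu (ball x0 (rho + eps)))).
  apply: le_measure; rewrite ?inE.
  - by apply: bigsetU_measurable => *; exact: measurable_mball.
  - exact: measurable_mball.
  - rewrite -bigcup_seq => z [u /= us]; apply: sub_ball.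
    move/allP : sb => /(_ u us) /ltW h; rewrite lerD// ler_pdivrMr// mulrDr mulr1.
    by rewrite lerDl ltW.
by rewrite -(@fineK _ (mu (ball x0 _))) ?lte_fin// mu_ball_fin// addr_gt0.
Qed.

Hypothesis mu_atomless : forall x : T, mu [set x] = 0%E.

(** The balls around x decrease to the null set {x}. *)
Lemma exists_small_ball (x : T) (e : R) : 0 < e ->
  exists j : nat, (mu (ball x (2 * j.+1%:R^-1)) < e%:E)%E.
Proof.
move=> e0.
have cv : (mu (ball x (2 * j.+1%:R^-1)) @[j --> \oo] --> mu (\bigcap_j ball x (2 * j.+1%:R^-1))).
  apply: nonincreasing_cvg_mu.
  - by rewrite mu_ball_lty.
  - by move=> i; exact: measurable_mball.
  - by apply: bigcap_measurable => // i _; exact: measurable_mball.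
  - move=> m n mn; apply/subsetPset; apply: sub_ball.
    by rewrite mdistxx add0r ler_wpM2l// lef_pV2 ?posrE// ler_nat.
have bx : \bigcap_j ball x (2 * j.+1%:R^-1) = [set x].
  apply/seteqP; split => [y h|y -> j _]; last first.
    by rewrite ballEmdist/= mdistxx mulr_gt0.
  apply/esym/eqP; rewrite -[_ == _]negbK -mdist_gt0 -leNgt.
  apply/ler_addgt0Pl => r r0; rewrite addr0 leNgt; apply/negP => ry.
  have [j hj] : exists j : nat, 0 + j.+1%:R^-1 < r / 2.
    by apply: ltr_add_invr; rewrite divr_gt0.
  have := h j Logic.I; rewrite ballEmdist/=; apply/negP; rewrite -leNgt.
  rewrite add0r in hj.
  by rewrite (le_trans _ (ltW ry))// mulrC -ler_pdivlMr// ltW.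
rewrite bx mu_atomless in cv.
have : nbhs (0%E : \bar R) [set z | (z < e%:E)%E].
  apply: open_nbhs_nbhs; split; last by rewrite /= lte_fin.
  exact: open_ereal_lt_ereal.
by move=> /cv[N _ /(_ N (leqnn N)) h]; exists N.
Qed.

(** At a given scale a net need not consist of centres of balls of small measure,
    but each point is caught at a scale that is fine enough for that point: a net
    ball containing x lies in the ball around x of twice its radius. *)
Lemma small_cover (e : R) : 0 < e -> exists U : nat -> set T,
  [/\ forall n, measurable (U n), forall n, (mu (U n) <= e%:E)%E &
      \bigcup_n U n = setT].
Proof.
move=> e0.
have [[x0]|/forallNP T0] := pselect (exists x : T, True); last first.
  exists (fun=> set0); split => //; first by move=> n; rewrite measure0 lee_fin ltW.
  by apply/seteqP; split => // x; have := T0 x.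
have /choice[s hs] : forall nj : nat * nat, exists s : seq T,
    forall x, ball x0 nj.1.+1%:R x -> exists2 y, y \in s & ball y nj.2.+1%:R^-1 x.
  by move=> nj; apply: finite_net.
pose B (nj : nat * nat) i := ball (nth x0 (s nj) i) nj.2.+1%:R^-1.
pose V nj i := if (mu (B nj i) <= e%:E)%E then B nj i else set0.
(* balls of the nets that are too large are discarded *)
pose U k := if unpickle k is Some (nj, i) then V nj i else set0.
have mV nj i : measurable (V nj i) /\ (mu (V nj i) <= e%:E)%E.
  rewrite /V; case: ifP => h; last by rewrite measure0 lee_fin ltW.
  by split => //; exact: measurable_mball.
exists U; split => [n|n|].
- by rewrite /U; case: unpickle => // -[nj i]; have [] := mV nj i.
- rewrite /U; case: unpickle => [[nj i]|]; first by have [] := mV nj i.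
  by rewrite measure0 lee_fin ltW.
- apply/seteqP; split => // x _.
  have [j hj] := exists_small_ball x e0.
  pose n := Num.truncn (mdist x0 x).
  have [|y ys yx] := hs (n, j) x.
    by rewrite ballEmdist/=; exact: truncnS_gt.
  (* the n-th ball around x0 contains x, and its j-th net catches x *)
  exists (pickle ((n, j), index y (s (n, j)))) => //.
  rewrite /U pickleK /V /B nth_index//= ifT//.
  apply: (le_trans _ (ltW hj)); apply: le_measure_ball.
  rewrite mulr2n mulrDl mul1r lerD2r metric_sym.
  by move: yx; rewrite ballEmdist/= => /ltW.
Qed.

(** Greedy choice: pieces of measure at most e are added until the next one would
    push the measure above m. *)
Lemma divisible_step (A : set T) (m e : R) : measurable A -> 0 <= m -> 0 < e ->
  (m%:E <= mu A)%E ->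
  exists B, [/\ measurable B, B `<=` A & ((m - e)%:E <= mu B <= m%:E)%E].
Proof.
move=> mA m0 e0 mAm; have [U [mU Ue UT]] := small_cover e0.
pose V k := A `&` \bigcup_(i < k) U i.
have mV k : measurable (V k).
  by apply: measurableI => //; apply: bigcup_measurable.
have VS k : V k.+1 = V k `|` (A `&` U k).
  by rewrite /V bigcup_mkord big_ord_recr/= -bigcup_mkord setIUr.
have V0 : V 0%N = set0 by rewrite /V bigcup_mkord big_ord0 setI0.
have VA : \bigcup_k V k = A.
  apply/seteqP; split => [x [k _ []]//|x Ax].
  have : [set: T] x by [].
  rewrite -UT => -[i _ Ux]; exists i.+1 => //; split => //.
  by exists i => //=.
have [exm|nexm] := pselect (exists k, (m%:E < mu (V k))%E).
  have [k mk kmin] := ex_minnP exm.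
  case: k mk kmin => [|k] mk kmin; first by move: mk; rewrite V0 measure0 lte_fin ltNge m0.
  exists (V k); split => //; first by move=> x [].
  apply/andP; split; last first.
    by rewrite leNgt; apply/negP => /kmin; rewrite ltnn.
  rewrite EFinB leeBlDr//; apply: (le_trans (ltW mk)); rewrite VS.
  apply: (le_trans (measureU2 _ _ _)) => //; first exact: measurableI.
  by apply: leeD => //; apply: (le_trans _ (Ue k)); exact: measureIr.
have mVm k : (mu (V k) <= m%:E)%E.
  by rewrite leNgt; apply/negP => h; apply: nexm; exists k.
exists A; split => //; rewrite (le_trans _ mAm) ?lee_fin ?gerBl ?(ltW e0)//=.
have cv : mu (V k) @[k --> \oo] --> mu (\bigcup_k V k).
  apply: nondecreasing_cvg_mu => //; first by rewrite VA.
  apply/nondecreasing_seqP => k; apply/subsetPset; rewrite VS; exact: subsetUl.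
rewrite -VA -(cvg_lim _ cv)//; apply: lime_le; first by apply/cvg_ex; eexists; exact: cv.
by apply: nearW.
Qed.

(** The greedy choice is iterated inside the complement of what has been chosen,
    with errors tending to 0; the union of the increasing sequence has measure m. *)
Lemma doubling_divisible : divisible mu.
Proof.
move=> A m mA m0 mAm.
pose good B := [/\ measurable B, B `<=` A & (mu B <= m%:E)%E].
have /choice[nxt hnxt] : forall p : set T * nat, exists B', good p.1 ->
    [/\ good B', p.1 `<=` B' & ((m - p.2.+1%:R^-1)%:E <= mu B')%E].
  move=> [B n] /=; have [gB|] := pselect (good B); last by exists set0.
  have [mB BA Bm] := gB.
  have fB : mu B \is a fin_num by rewrite ge0_fin_numE// (le_lt_trans Bm)// ltry.
  have mAB : measurable (A `\` B) by exact: measurableD.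
  have mB0 : 0 <= m - fine (mu B) by rewrite subr_ge0 -lee_fin fineK.
  have ABm : ((m - fine (mu B))%:E <= mu (A `\` B))%E.
    rewrite EFinB fineK// leeBlDr// -measureU//; last exact: setDKI.
    by rewrite setDKU.
  have n0 : 0 < n.+1%:R^-1 :> R by [].
  have [D [mD DA /andP[Dm1 Dm2]]] := divisible_step mAB mB0 n0 ABm.
  have muBD : mu (B `|` D) = (mu B + mu D)%E.
    by rewrite measureU// -subset0 => x [Bx /DA[]].
  exists (B `|` D) => _; split; last 2 first.
  - exact: subsetUl.
  - rewrite muBD -leeBlDl//; apply: (le_trans _ Dm1).
    by rewrite -[in leLHS](fineK fB) -EFinB lee_fin addrAC.
  split; first exact: measurableU.
  - by rewrite subUset; split => // x /DA[].
  - by rewrite muBD -leeBrDl// -[in leRHS](fineK fB) -EFinB.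
pose Bs := fix F n := if n is n'.+1 then nxt (F n', n') else set0.
have gBs n : good (Bs n).
  elim: n => [|n IH]; last by have [] := hnxt (Bs n, n) IH.
  by split; [exact: measurable0|exact: sub0set|rewrite /= measure0 lee_fin].
have mBs n : measurable (Bs n) by have [] := gBs n.
have cv : mu (Bs k) @[k --> \oo] --> mu (\bigcup_k Bs k).
  apply: nondecreasing_cvg_mu => //; first exact: bigcup_measurable.
  apply/nondecreasing_seqP => k; apply/subsetPset.
  by have [] := hnxt (Bs k, k) (gBs k).
exists (\bigcup_k Bs k); split.
- exact: bigcup_measurable.
- by apply: bigcup_sub => n _; have [] := gBs n.
have ccv : cvg (mu (Bs k) @[k --> \oo]) by apply/cvg_ex; eexists; exact: cv.
apply/eqP; rewrite eq_le; apply/andP; split.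
  rewrite -(cvg_lim _ cv)//; apply: lime_le => //.
  by apply: nearW => n; have [] := gBs n.
apply/lee_addgt0Pr => e e0; have [n hn] : exists n : nat, 0 + n.+1%:R^-1 < e.
  exact: ltr_add_invr.
rewrite -leeBlDr// -EFinB.
apply: (@le_trans _ _ (mu (Bs n.+1))); last first.
  by apply: le_measure; rewrite ?inE//; [exact: bigcup_measurable|exact: bigcup_sup].
have [_ _ /=] := hnxt (Bs n, n) (gBs n); apply: le_trans.
by rewrite lee_fin lerB// ltW// -[ltLHS]add0r.
Qed.

End atomless_doubling.

(** * Decreasing rearrangements *)
Section rearr_theory.
Context {R : realType} {d : measure_display} {T : measurableType d}.
Variable mu : {measure set T -> \bar R}.
Implicit Types (f g : T -> R) (s t : R).

Lemma rearr_ge0 f t : (0 <= rearr mu f t)%E.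
Proof. by apply: le_ereal_inf_tmp => _ [s [s0 _] <-]; rewrite lee_fin. Qed.

Lemma rearr_anti f s t : s <= t -> (rearr mu f t <= rearr mu f s)%E.
Proof.
move=> st; apply: ereal_inf_le_tmp => _ [u [u0 hu] <-].
by exists u => //; split => //; apply: (le_trans hu); rewrite lee_fin.
Qed.

Lemma rearr_le f s t : 0 <= s -> (distrib_fun mu f s <= t%:E)%E ->
  (rearr mu f t <= s%:E)%E.
Proof. by move=> s0 h; apply: ereal_inf_lbound; exists s. Qed.

Lemma lt_rearr f s t : 0 <= s -> (s%:E < rearr mu f t)%E ->
  (t%:E < distrib_fun mu f s)%E.
Proof.
by move=> s0; rewrite !ltNge; apply: contra => h; exact: rearr_le.
Qed.

Lemma eq_rearr f g t : (forall s, 0 <= s -> distrib_fun mu f s = distrib_fun mu g s) ->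
  rearr mu f t = rearr mu g t.
Proof.
move=> fg; congr ereal_inf; apply/seteqP; split => _ [s [s0 h] <-]; exists s => //.
  by split => //; rewrite -fg.
by split => //; rewrite fg.
Qed.

Lemma measurable_rearr f (D : set R) : measurable D -> measurable_fun D (rearr mu f).
Proof.
move=> mD; apply: (measurability _ (ErealGenCInfty.measurableE R)) => //.
move=> _ [_ [r ->] <-]; apply: measurableI => //.
apply: is_interval_measurable => s t /=.
rewrite !in_itv/= !andbT => fs ft u /andP[su ut].
by rewrite in_itv/= andbT (le_trans ft)// rearr_anti.
Qed.

Lemma measurable_level f s : measurable_fun setT f ->
  measurable [set x | s < `|f x|].
Proof.
move=> mf; have /(_ measurableT `]s, +oo[%classic) : measurable_fun setT (@Num.norm R R \o f).
  exact: measurableT_comp.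
rewrite setTI; have -> : (@Num.norm R R \o f) @^-1` `]s, +oo[ = [set x | s < `|f x|].
  by apply/seteqP; split => x /=; rewrite in_itv/= andbT.
by apply; exact: measurable_itv.
Qed.

Lemma distrib_anti f s t : measurable_fun setT f -> s <= t ->
  (distrib_fun mu f t <= distrib_fun mu f s)%E.
Proof.
move=> mf st; apply: le_measure; rewrite ?inE; [exact: measurable_level..|].
by move=> x /=; exact: le_lt_trans.
Qed.

(** The infimum defining the rearrangement is attained, since the distribution
    function is continuous from the right. *)
Lemma distrib_rearr f s t : measurable_fun setT f -> (rearr mu f t <= s%:E)%E ->
  (distrib_fun mu f s <= t%:E)%E.
Proof.
move=> mf rs.
pose F n := [set x | s + n.+1%:R^-1 < `|f x|].
have mF n : measurable (F n) by exact: measurable_level.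
have cv : mu (F n) @[n --> \oo] --> mu (\bigcup_n F n).
  apply: nondecreasing_cvg_mu => //; first exact: bigcup_measurable.
  apply/nondecreasing_seqP => n; apply/subsetPset => x; apply: le_lt_trans.
  by rewrite lerD2l lef_pV2 ?posrE// ler_nat.
have FE : \bigcup_n F n = [set x | s < `|f x|].
  apply/seteqP; split => [x [n _] /=|x /= sx].
    by apply: le_lt_trans; rewrite lerDl.
  by have [n hn] := ltr_add_invr sx; exists n.
rewrite /distrib_fun -FE -(cvg_lim _ cv)//; apply: lime_le.
  by apply/cvg_ex; eexists; exact: cv.
apply: nearW => n.
have : (rearr mu f t < (s + n.+1%:R^-1)%:E)%E.
  by apply: (le_lt_trans rs); rewrite lte_fin ltrDl.
move=> /ereal_inf_lt[_ [u [u0 hu] <-]]; rewrite lte_fin => us.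
by apply: (le_trans _ hu); apply: distrib_anti => //; exact: ltW.
Qed.

(** One superlevel set of finite measure suffices: the higher ones decrease to
    the empty set. *)
Lemma rearr_lty f s t : measurable_fun setT f -> (distrib_fun mu f s < +oo)%E ->
  0 < t -> (rearr mu f t < +oo)%E.
Proof.
move=> mf fs t0.
pose F n := [set x | s + n%:R < `|f x|].
have mF n : measurable (F n) by exact: measurable_level.
have cv : mu (F n) @[n --> \oo] --> mu (\bigcap_n F n).
  apply: nonincreasing_cvg_mu => //.
  - by apply: (le_lt_trans _ fs); apply: distrib_anti => //; rewrite addr0.
  - by apply: bigcap_measurable.
  - move=> m n mn; apply/subsetPset => x; apply: le_lt_trans.
    by rewrite lerD2l ler_nat.
have F0 : \bigcap_n F n = set0.
  rewrite -subset0 => x h.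
  have := h (Num.truncn (`|f x| - s)).+1 Logic.I; rewrite /F/= -ltrBrDl.
  by apply/negP; rewrite -leNgt ltW// truncnS_gt.
rewrite F0 measure0 in cv.
have : nbhs (0%E : \bar R) [set z | (z < t%:E)%E].
  apply: open_nbhs_nbhs; split; last by rewrite /= lte_fin.
  exact: open_ereal_lt_ereal.
move=> /cv[N _ /= hN].
pose u := Num.max 0 (s + N%:R).
apply: (@le_lt_trans _ _ u%:E); last exact: ltry.
apply: rearr_le; first by rewrite le_max lexx.
apply: (le_trans _ (ltW (hN N (leqnn N)))).
by apply: distrib_anti => //; rewrite le_max lexx orbT.
Qed.

End rearr_theory.

(** * Slices between consecutive quantiles *)
Section slicing.
Context {R : realType} {d : measure_display} {T : measurableType d}.
Variable mu : {measure set T -> \bar R}.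
Hypothesis mu_div : divisible mu.
Hypothesis mu_inf : mu setT = +oo%E.
Variable v : T -> R.
Hypothesis mv : measurable_fun setT v.
Hypothesis v0 : forall x, 0 <= v x.
Hypothesis v_fin : forall s, 0 < s -> (distrib_fun mu v s < +oo)%E.

Lemma measurable_ge_level s : measurable [set x | s <= v x].
Proof.
have /(_ measurableT `[s, +oo[%classic) := mv.
rewrite setTI; have -> : v @^-1` `[s, +oo[ = [set x | s <= v x].
  by apply/seteqP; split => x /=; rewrite in_itv/= andbT.
by apply; exact: measurable_itv.
Qed.

Lemma rearr_fin t : 0 < t -> rearr mu v t \is a fin_num.
Proof.
move=> t0; rewrite ge0_fin_numE ?rearr_ge0//.
exact: (rearr_lty mv (v_fin ltr01)).
Qed.

Let c t := fine (rearr mu v t).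

(** The set where v >= v*(t) is the intersection of the superlevel sets at heights
    below v*(t), each of measure above t and finite, unless v*(t) = 0, when it is
    the whole space. *)
Lemma ge_level_measure t : 0 < t -> (t%:E <= mu [set x | (c t <= v x)%R])%E.
Proof.
move=> t0; have c0 : 0 <= c t by rewrite fine_ge0// rearr_ge0.
have [c00|cpos] := eqVneq (c t) 0.
  suff -> : [set x | c t <= v x] = setT by rewrite mu_inf leey.
  by apply/seteqP; split => // x _; rewrite /= c00.
have {}cpos : 0 < c t by rewrite lt_neqAle eq_sym cpos.
pose e n := c t * (n.+2%:R^-1 : R).
have e1 n : e n < c t by rewrite gtr_pMr// invf_lt1// ltr1n.
pose F n := [set x | c t - e n < `|v x|].
have mF n : measurable (F n) by exact: measurable_level.
have cv : mu (F n) @[n --> \oo] --> mu (\bigcap_n F n).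
  apply: nonincreasing_cvg_mu => //.
  - by apply: v_fin; rewrite subr_gt0.
  - by apply: bigcap_measurable.
  - move=> m n mn; apply/subsetPset => x; apply: le_lt_trans.
    by rewrite lerD2l lerN2 ler_pM2l// lef_pV2 ?posrE// ler_nat.
have FE : \bigcap_n F n = [set x | c t <= v x].
  apply/seteqP; split => [x h /=|x /= cx n _]; last first.
    by rewrite /F/= ger0_norm// (lt_le_trans _ cx)// ltrBlDr ltrDl mulr_gt0.
  apply/ler_addgt0Pr => r r0.
  have [n hn] : exists n : nat, 0 + n.+1%:R^-1 < r / c t.
    by apply: ltr_add_invr; rewrite divr_gt0.
  have /ltW := h n Logic.I; rewrite ger0_norm// lerBlDr => /le_trans; apply.
  rewrite lerD2l /e mulrC -ler_pdivlMr// (le_trans _ (ltW hn))// add0r.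
  by rewrite lef_pV2 ?posrE// ler_nat.
rewrite -FE -(cvg_lim _ cv)//; apply: lime_ge.
  by apply/cvg_ex; eexists; exact: cv.
apply: nearW => n; apply: ltW; apply: lt_rearr.
  by rewrite subr_ge0 ltW.
by rewrite -[ltRHS](fineK (rearr_fin t0)) lte_fin gtrBl mulr_gt0.
Qed.

Lemma level_measure t : 0 < t -> (mu [set x | (c t < v x)%R] <= t%:E)%E.
Proof.
move=> t0; have := @distrib_rearr _ _ _ mu v (c t) t mv.
rewrite (fineK (rearr_fin t0)) => /(_ (lexx _)); rewrite /distrib_fun.
by under eq_set do rewrite ger0_norm//.
Qed.

(** A set H between the strict and the large superlevel set at height v*(t) is
    enlarged within the latter, which has measure at least t. *)
Lemma quantile_step t (H : set T) : 0 < t -> measurable H ->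
  [set x | c t < v x] `<=` H -> H `<=` [set x | c t <= v x] ->
  (mu H <= t%:E)%E ->
  exists G, [/\ measurable G, H `<=` G, G `<=` [set x | c t <= v x] &
                mu G = t%:E].
Proof.
move=> t0 mH cH Hc Ht.
have fH : mu H \is a fin_num by rewrite ge0_fin_numE// (le_lt_trans Ht)// ltry.
have mL := measurable_ge_level (c t).
have mLH : measurable ([set x | c t <= v x] `\` H) by exact: measurableD.
have [||D [mD DL muD]] := @mu_div _ (t - fine (mu H)) mLH.
- by rewrite subr_ge0 -lee_fin fineK.
- rewrite EFinB fineK// leeBlDr// -measureU//; last exact: setDKI.
  by rewrite setDKU// ge_level_measure.
exists (H `|` D); split.
- exact: measurableU.
- exact: subsetUl.
- by rewrite subUset; split => // x /DL[].
- have -> : mu (H `|` D) = (mu H + mu D)%E.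
    by rewrite measureU// -subset0 => x [Hx /DL[]].
  by rewrite muD -[X in (X + _)%E](fineK fH) -EFinD addrC subrK.
Qed.

(** Going from height v*(i tau) to v*((i+1) tau), the set constructed so far lies
    in the new strict superlevel set if the height drops, and contains it if the
    height stays the same; in both cases [quantile_step] applies to their union. *)
Lemma quantile_chain (tau : R) : 0 < tau -> exists G : nat -> set T,
  forall i, [/\ measurable (G i), G i `<=` G i.+1, mu (G i) = (i%:R * tau)%:E &
     forall x, G i.+1 x -> (rearr mu v (i.+1%:R * tau) <= (v x)%:E)%E].
Proof.
move=> tau0.
have it0 i : 0 < i.+1%:R * tau by rewrite mulr_gt0.
pose C i := c (i.+1%:R * tau).
pose good (i : nat) (G : set T) := [/\ measurable G, [set x | C i < v x] `<=` G,
   G `<=` [set x | C i <= v x] & mu G = (i.+1%:R * tau)%:E].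
have [G0 gG0] : exists G, good 0%N G.
  have [||||G [mG HG Gc muG]] := @quantile_step (1 * tau) [set x | C 0%N < v x] (it0 0%N).
  - have := measurable_level (C 0%N) mv.
    by under eq_set do rewrite ger0_norm//.
  - by [].
  - by move=> x /ltW.
  - exact: level_measure.
  by exists G; split.
have /choice[nxt hnxt] : forall p : set T * nat, exists G', good p.2 p.1 ->
    good p.2.+1 G' /\ p.1 `<=` G'.
  move=> [G i] /=; have [[mG cG Gc muG]|] := pselect (good i G); last by exists set0.
  have CC : C i.+1 <= C i.
    rewrite -lee_fin !fineK ?rearr_fin//; apply: rearr_anti.
    by rewrite ler_pM2r// ler_nat.
  have mL : measurable [set x | C i.+1 < v x].
    have := measurable_level (C i.+1) mv.
    by under eq_set do rewrite ger0_norm//.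
  have [||||G' [mG' HG' Gc' muG']] := @quantile_step (i.+2%:R * tau) (G `|` [set x | C i.+1 < v x]) (it0 i.+1).
  - exact: measurableU.
  - exact: subsetUr.
  - rewrite subUset; split => x; first by move=> /Gc/(le_trans CC).
    by move=> /ltW.
  - move: CC; rewrite le_eqVlt => /predU1P[CE|CC].
      rewrite (_ : _ `|` _ = G); last by apply/setUidPl; rewrite CE.
      by rewrite muG lee_fin ler_pM2r// ler_nat.
    rewrite (_ : _ `|` _ = [set x | C i.+1 < v x]); first exact: level_measure.
    by apply/setUidPr => x /Gc; exact: lt_le_trans.
  exists G' => _; split; last by apply: subset_trans HG'; exact: subsetUl.
  by split => //; apply: subset_trans HG'; exact: subsetUr.
pose Gs := fix F n := if n is n'.+1 then nxt (F n', n') else G0.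
have gGs n : good n (Gs n).
  by elim: n => // n IH; have [] := hnxt (Gs n, n) IH.
exists (fun i => if i is i'.+1 then Gs i' else set0) => i.
split.
- by case: i => // i; have [] := gGs i.
- by case: i => // i; have [] := hnxt (Gs i, i) (gGs i).
- by case: i => [|i]; [rewrite measure0 mul0r|have [] := gGs i].
- move=> x; have [_ _ h _] := gGs i => /h /=.
  by rewrite -lee_fin fineK// rearr_fin.
Qed.

(** The successive differences of the chain: a discrete measure preserving
    parametrization of v by its rearrangement. *)
Lemma quantile_slices (tau : R) : 0 < tau -> exists B : nat -> set T,
  [/\ forall i, measurable (B i), forall i, mu (B i) = tau%:E, trivIset setT B &
     forall i x, B i x -> (rearr mu v (i.+1%:R * tau) <= (v x)%:E)%E].
Proof.
move=> tau0; have [G hG] := quantile_chain tau0.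
have mG i : measurable (G i) by have [] := hG i.
have GS i : G i `<=` G i.+1 by have [] := hG i.
have muG i : mu (G i) = (i%:R * tau)%:E by have [] := hG i.
have GG i j : (i <= j)%N -> G i `<=` G j.
  by move=> /subnK <-; elim: (j - i)%N => // n IH; exact: subset_trans (GS _).
exists (fun i => G i.+1 `\` G i); split.
- by move=> i; exact: measurableD.
- move=> i; have -> : mu (G i.+1 `\` G i) = (mu (G i.+1) - mu (G i))%E.
    rewrite measureD//; last by apply: (le_lt_trans _ (ltry (i.+1%:R * tau))); rewrite -muG.
    by rewrite (_ : _ `&` _ = G i)//; exact/setIidPr.
  by rewrite !muG -EFinB -mulrBl -natrB// subSnn mul1r.
- apply/trivIsetP => i j _ _; rewrite neq_ltn => /orP[] ij; rewrite -subset0 => x [[h1 h2] [h3 h4]].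
    exact/h4/(GG i.+1).
  exact/h2/(GG j.+1).
- by move=> i x [Gx _]; have [_ _ _] := hG i; apply.
Qed.

End slicing.

(** * Integrals of rearrangements *)
Section rearr_integral.
Context {R : realType} {d : measure_display} {T : measurableType d}.
Variable mu : {measure set T -> \bar R}.
Local Notation leb := (@lebesgue_measure R).

Lemma int_rearr_upper_sum (f : T -> R) (tau : R) n : 0 < tau ->
  (\int[leb]_(s in `[tau, (n.+1%:R * tau)%R[) rearr mu f s
   <= \sum_(i < n) tau%:E * rearr mu f (i.+1%:R * tau)%R)%E.
Proof.
move=> tau0; elim: n => [|n IH].
  by rewrite mul1r set_itvco0 integral_set0 big_ord0.
rewrite big_ord_recr/=.
have -> : `[tau, n.+2%:R * tau[%classic =
    `[tau, n.+1%:R * tau[ `|` `[n.+1%:R * tau, n.+2%:R * tau[.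
  rewrite -itv_bndbnd_setU// bnd_simp; first by rewrite ler_peMl ?ler1n// ltW.
  by rewrite ler_pM2r// ler_nat.
rewrite ge0_integral_setU//; first 1 last.
- by apply: measurable_rearr; exact: measurableU.
- by move=> x _; exact: rearr_ge0.
- by apply: lt_disjoint => x y; rewrite !in_itv/= => /andP[_ /lt_le_trans h] /andP[/h].
apply: leeD => //.
have <- : (\int[leb]_(s in `[(n.+1%:R * tau)%R, (n.+2%:R * tau)%R[)
    cst (rearr mu f (n.+1%:R * tau)%R) s = tau%:E * rearr mu f (n.+1%:R * tau)%R)%E.
  rewrite integral_cst//= lebesgue_measure_itv/= lte_fin ltr_pM2r// ltr_nat leqnn.
  by rewrite -EFinB -mulrBl -natrB// subSnn mul1r muleC.
apply: ge0_le_integral => //.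
- by move=> x _; exact: rearr_ge0.
- exact: measurable_rearr.
- by move=> x /=; rewrite in_itv/= => /andP[h _]; exact: rearr_anti.
Qed.

(** The lower sums bound the integral over [t / (n+1), t) only: the rearrangement
    may be unbounded near 0.  Refining the mesh exhausts (0, t). *)
Lemma int_rearr_le (f : T -> R) (t : R) (K : \bar R) : 0 < t ->
  (forall n, \sum_(i < n) (t / n.+1%:R)%:E * rearr mu f (i.+1%:R * (t / n.+1%:R))%R <= K)%E ->
  (\int[leb]_(s in `]0%R, t[) rearr mu f s <= K)%E.
Proof.
move=> t0 hK.
pose F n := `[t / n.+1%:R, t[%classic.
have FE : \bigcup_n F n = `]0, t[%classic.
  apply/seteqP; split => [x [n _]|x]; rewrite /F /= !in_itv/= => /andP[h1 h2].
    by rewrite h2 andbT (lt_le_trans _ h1)// divr_gt0.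
  have [n hn] : exists n : nat, 0 + n.+1%:R^-1 < x / t.
    by apply: ltr_add_invr; rewrite divr_gt0.
  exists n => //=; rewrite in_itv/= h2 andbT ltW// mulrC -ltr_pdivlMr//.
  by rewrite -[ltLHS]add0r.
have cv : (\int[leb]_(s in F n) rearr mu f s)%E @[n --> \oo] -->
    (\int[leb]_(s in \bigcup_n F n) rearr mu f s)%E.
  apply: ge0_nondecreasing_set_cvg_integral => //.
  - move=> m n mn; apply/subsetPset => x; rewrite /F /= !in_itv/= => /andP[h ->].
    by rewrite andbT (le_trans _ h)// ler_pM2l// lef_pV2 ?posrE// ler_nat.
  - by move=> i; exact: measurable_itv.
  - by move=> i; apply: measurable_rearr; exact: measurable_itv.
  - by move=> i x _; exact: rearr_ge0.
rewrite -FE -(cvg_lim _ cv)//; apply: lime_le.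
  by apply/cvg_ex; eexists; exact: cv.
apply: nearW => n; apply: (le_trans _ (hK n)); rewrite /F.
have tn : 0 < t / n.+1%:R by rewrite divr_gt0.
have := int_rearr_upper_sum f n tn.
by rewrite mulrCA mulfV// mulr1.
Qed.

Hypothesis mu_div : divisible mu.
Hypothesis mu_inf : mu setT = +oo%E.

(** One half of the equimeasurability of v and v*, obtained from the slices instead of
    the layer cake formula. *)
Lemma int_rearr_le_integral (v : T -> R) (t : R) : measurable_fun setT v ->
  (forall x, 0 <= v x) -> (forall s, 0 < s -> (distrib_fun mu v s < +oo)%E) ->
  0 < t ->
  (\int[leb]_(s in `]0%R, t[) rearr mu v s <= \int[mu]_x (v x)%:E)%E.
Proof.
move=> mv v0 vfin t0; apply: int_rearr_le => // n.
set tau := t / n.+1%:R.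
have tau0 : 0 < tau by rewrite divr_gt0.
have [B [mB muB tB Bv]] := quantile_slices mu_div mu_inf mv v0 vfin tau0.
have mev D : measurable_fun D (EFin \o v).
  by apply/measurable_EFinP; exact: measurable_funTS.
apply: (@le_trans _ _ (\sum_(i < n) \int[mu]_(x in B i) (v x)%:E)%E).
  apply: lee_sum => i _.
  rewrite muleC -(muB i) -integral_cst//; apply: ge0_le_integral => //.
  - by move=> x _; exact: rearr_ge0.
  - by move=> x; exact: Bv.
rewrite -(big_mkord xpredT (fun i => \int[mu]_(x in B i) (v x)%:E)%E).
rewrite -ge0_integral_bigsetU//=; last 3 first.
- exact: iota_uniq.
- exact: sub_trivIset tB.
- by move=> x _; rewrite lee_fin.
apply: ge0_subset_integral => //.
by apply: bigsetU_measurable.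
by move=> x _; rewrite lee_fin.
Qed.

End rearr_integral.

Lemma measure_equal_pieces (R : realType) (d : measure_display) (T : measurableType d)
    (mu : {measure set T -> \bar R}) (B : nat -> set T) (tau : R) n :
  (forall i, measurable (B i)) -> (forall i, mu (B i) = tau%:E) ->
  trivIset setT B ->
  mu (\big[setU/set0]_(i < n) B i) = (n%:R * tau)%:E.
Proof.
move=> mB muB tB.
rewrite (@measure_bigsetU_ord _ _ _ mu _ xpredT (fun i : 'I_n => B i))//; last first.
  by move=> i1 i2 _ _ h; apply/val_inj; exact: tB.
have -> : (n%:R * tau)%:E = (\sum_(i < n) tau%:E)%E.
  by rewrite sumEFin sumr_const card_ord mulr_natl.
by apply: eq_bigr => i _; exact: muB.
Qed.

(** * Averaging in rearrangement invariant spaces *)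
Section qri.
Context {R : realType} {d : measure_display} {T : measurableType d}.
Variable mu : {measure set T -> \bar R}.
Variable X : qri_space mu.

(** The sequence u, f, f, f, ... increases to f, so the Fatou axiom provides the
    lattice property. *)
Lemma qri_mono (u f : T -> R) : qri_car X f -> measurable_fun setT u ->
  (forall x, 0 <= u x <= f x) -> qri_car X u /\ qri_norm X u <= qri_norm X f.
Proof.
move=> Xf meas_u uf.
pose w n := if n is 0%N then u else f.
have [||w1 w2 _] := @qri_fatou _ _ _ _ X w f _ Xf.
- by case => //= _; exact: qri_meas Xf.
- apply: aeW => x; split.
    by case => [|n] /=; [exact: uf|rewrite lexx andbT; have /andP[/le_trans h /h] := uf x].
  rewrite -(cvg_shiftS (fun n => w n x)) /=; exact: cvg_cst.
by split; [exact: (w1 0%N)|exact: (w2 0%N)].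
Qed.

Lemma qri_norm_indic_eq (E F : set T) : measurable E -> measurable F ->
  (mu E < +oo)%E -> mu E = mu F -> qri_norm X \1_E = qri_norm X \1_F.
Proof.
move=> mE mF Efin EF; apply: (qri_rearr (qri_indic X mE Efin) _ _).2.
  exact: measurable_indic.
move=> t t0; apply: eq_rearr => s s0.
have dE (A : set T) : distrib_fun mu \1_A s = if s < 1 then mu A else 0%E.
  rewrite /distrib_fun; case: ifPn => s1.
    congr (mu _); apply/seteqP; split => x /=; rewrite indicE.
      case: (boolP (x \in A)) => [/set_mem//|_]; rewrite normr0 ltNge s0//.
    by move=> Ax; rewrite mem_set// normr1.
  rewrite (_ : [set _ | _] = set0) ?measure0// -subset0 => x /=; rewrite indicE.
  rewrite -leNgt in s1.
  by case: (_ \in _); rewrite ?normr1 ?normr0 ltNge ?s1 ?s0.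
by rewrite !dE EF.
Qed.

Hypothesis X_ri : is_ri X.

Lemma qri_norm0 : qri_car X (cst 0) /\ qri_norm X (cst 0) = 0.
Proof.
have X0 : qri_car X (cst 0).
  have := @qri_indic _ _ _ _ X set0 measurable0; rewrite measure0 => /(_ (ltry _)).
  by congr qri_car; apply/funext => x; rewrite indicE in_set0.
by split => //; apply/(qri_null X0); exact: aeW.
Qed.

Lemma ri_sum (I : Type) (s : seq I) (w : I -> T -> R) :
  (forall i, qri_car X (w i)) ->
  qri_car X (fun x => \sum_(i <- s) w i x) /\
  qri_norm X (fun x => \sum_(i <- s) w i x) <= \sum_(i <- s) qri_norm X (w i).
Proof.
move=> Xw; elim: s => [|i s [IH1 IH2]].
  have [X0 n0] := qri_norm0.
  rewrite big_nil (_ : (fun x => _) = cst 0)//; first by rewrite n0.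
  by apply/funext => x; rewrite big_nil.
rewrite (_ : (fun x => _) = w i \+ (fun x => \sum_(j <- s) w j x)).
  split; first exact: qri_add.
  by rewrite big_cons; apply: (le_trans (X_ri _ _)) => //; rewrite lerD2l.
by apply/funext => x; rewrite big_cons.
Qed.

(** The step functions that put the values a_i, shifted cyclically by k, on the
    sets B_i are equimeasurable for k = 0, ..., n, and the first one is at most v.
    Their sum is the constant sum of the a_i on the union of the B_i. *)
Lemma ri_average (n : nat) (B : nat -> set T) (tau : R) (a : 'I_n.+1 -> R)
    (v : T -> R) : 0 < tau ->
  (forall i, measurable (B i)) -> (forall i, mu (B i) = tau%:E) ->
  trivIset setT B -> (forall i, 0 <= a i) -> qri_car X v ->
  (forall x, 0 <= v x) -> (forall (i : 'I_n.+1) x, B i x -> a i <= v x) ->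
  (\sum_i a i) * qri_norm X \1_(\big[setU/set0]_(i < n.+1) B i)
     <= n.+1%:R * qri_norm X v.
Proof.
move=> tau0 mB muB tB a0 Xv v0 av.
pose w (k : 'I_n.+1) x := \sum_i a (i + k) * \1_(B i) x.
have wB k (j : 'I_n.+1) x : B j x -> w k x = a (j + k).
  move=> Bx; rewrite /w (bigD1 j)//= big1 ?addr0.
    by rewrite indicE mem_set// mulr1.
  move=> i ij; rewrite indicE memNset ?mulr0// => Bi.
  have /trivIsetP := tB => /(_ i j Logic.I Logic.I).
  by move=> /(_ ij)/seteqP[+ _] => /(_ x (conj Bi Bx)).
have inU x : (\big[setU/set0]_(i < n.+1) B i) x -> exists j : 'I_n.+1, B j x.
  by rewrite -bigcup_mkord => -[i /= iN Bi]; exists (Ordinal iN).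
have wN k x : ~ (\big[setU/set0]_(i < n.+1) B i) x -> w k x = 0.
  move=> nB; rewrite /w big1// => i _; rewrite indicE memNset ?mulr0// => Bi.
  by apply: nB; rewrite -bigcup_mkord; exists i => /=.
have mw k : measurable_fun setT (w k).
  apply: measurable_sum => i; apply: measurable_funM => //.
have dw k s : 0 <= s -> distrib_fun mu (w k) s = distrib_fun mu (w 0) s.
  move=> s0.
  have dE j : distrib_fun mu (w j) s = (\sum_(i < n.+1 | (s < a i)%R) tau%:E)%E.
    rewrite (reindex_inj (addIr j))/=.
    have -> : (\sum_(i < n.+1 | (s < a (i + j))%R) tau%:E =
        \sum_(i < n.+1 | (s < a (i + j))%R) mu (B i))%E by apply: eq_bigr.
    rewrite -(@measure_bigsetU_ord_cond _ _ _ mu _ (fun i : 'I_n.+1 => s < a (i + j)) (fun i : 'I_n.+1 => B i))//; last first.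
      by move=> i1 i2 _ _ h; apply/val_inj; exact: tB.
    rewrite -(bigcup_pred [pred i : 'I_n.+1 | s < a (i + j)] (fun i : 'I_n.+1 => B i)).
    rewrite /distrib_fun; congr (mu _); apply/seteqP; split => x /=.
      have [/inU[i Bi]|nB] := pselect ((\big[setU/set0]_(i < n.+1) B i) x); last first.
        by rewrite wN// normr0 ltNge s0.
      by rewrite (wB j i)// ger0_norm// => sa; exists i.
    by move=> [i /=]; rewrite inE => sa Bi; rewrite (wB j i)// ger0_norm.
  by rewrite !dE.
have [Xw0 nw0] : qri_car X (w 0) /\ qri_norm X (w 0) <= qri_norm X v.
  apply: qri_mono => // x.
  have [/inU[i Bi]|nB] := pselect ((\big[setU/set0]_(i < n.+1) B i) x).
    by rewrite (wB _ i)// addr0 a0 av.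
  by rewrite wN// lexx v0.
have Xw k : qri_car X (w k) /\ qri_norm X (w 0) = qri_norm X (w k).
  apply: qri_rearr => // t t0; apply: eq_rearr => s s0.
  by rewrite dw.
have [_] := ri_sum (index_enum 'I_n.+1) (fun k => (Xw k).1).
have -> : (fun x => \sum_k w k x) =
    (fun x => (\sum_i a i) * \1_(\big[setU/set0]_(i < n.+1) B i) x).
  apply/funext => x.
  have [Ux|nB] := pselect ((\big[setU/set0]_(i < n.+1) B i) x); last first.
    by rewrite indicE memNset// mulr0 big1// => k _; exact: wN.
  rewrite indicE mem_set// mulr1; have [i Bi] := inU _ Ux.
  by rewrite [RHS](reindex_inj (addrI i)); apply: eq_bigr => k _; exact: wB.
rewrite qri_homo; last first.
  apply: qri_indic; first exact: bigsetU_measurable.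
  by rewrite (measure_equal_pieces _ mB muB tB) ltry.
rewrite ger0_norm ?sumr_ge0// => /le_trans; apply.
apply: (@le_trans _ _ (\sum_(k < n.+1) qri_norm X v)).
  by apply: ler_sum => k _; rewrite -(Xw k).2.
by rewrite sumr_const card_ord mulr_natl.
Qed.

Hypothesis mu_div : divisible mu.
Hypothesis mu_inf : mu setT = +oo%E.

(** The Hardy-Littlewood and Hoelder inequalities for r.i. norms in one step.  The
    values of v* at multiples of t / (n+1) are averaged over slices of v; the
    union of the slices has measure t, so its indicator has the same norm as that
    of E. *)
Lemma ri_int_rearr (v : T -> R) (E : set T) (t : R) : 0 < t ->
  measurable E -> mu E = t%:E -> qri_car X v -> (forall x, 0 <= v x) ->
  (forall s, 0 < s -> (distrib_fun mu v s < +oo)%E) ->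
  ((\int[@lebesgue_measure R]_(s in `]0%R, t[) rearr mu v s) * (qri_norm X \1_E)%:E
    <= (t * qri_norm X v)%:E)%E.
Proof.
move=> t0 mE muE Xv v0 vfin.
have mv := qri_meas Xv.
have XE : qri_car X \1_E by apply: qri_indic => //; rewrite muE ltry.
have nE : 0 < qri_norm X \1_E.
  rewrite lt_neqAle qri_ge0// andbT eq_sym; apply/eqP => /(qri_null XE)[N [mN N0 hN]].
  have : (mu E <= 0)%E.
    rewrite -N0; apply: le_measure; rewrite ?inE// => x Ex; apply: hN => /=.
    by rewrite indicE mem_set//; exact/eqP/oner_neq0.
  by rewrite muE lee_fin leNgt t0.
rewrite -lee_pdivlMr// -EFinM.
apply: int_rearr_le => // n.
set tau := t / n.+1%:R.
have tau0 : 0 < tau by rewrite divr_gt0.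
have it0 i : 0 < i.+1%:R * tau by rewrite mulr_gt0.
have [B [mB muB tB Bv]] := quantile_slices mu_div mu_inf mv v0 vfin tau0.
pose a (i : nat) := fine (rearr mu v (i.+1%:R * tau)).
have aE i : rearr mu v (i.+1%:R * tau) = (a i)%:E.
  by rewrite fineK// (rearr_fin mv vfin).
have a0 i : 0 <= a i by rewrite fine_ge0// rearr_ge0.
have := @ri_average n B tau (fun i => a i) v tau0 mB muB tB (fun i => a0 i) Xv v0.
have -> : qri_norm X \1_(\big[setU/set0]_(i < n.+1) B i) = qri_norm X \1_E.
  have muU : mu (\big[setU/set0]_(i < n.+1) B i) = t%:E.
    by rewrite (measure_equal_pieces _ mB muB tB) mulrC divfK.
  apply: qri_norm_indic_eq => //; first exact: bigsetU_measurable.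
  - by rewrite muU ltry.
  - by rewrite muU muE.
have aB (i : 'I_n.+1) x : B i x -> a i <= v x by move=> /Bv; rewrite aE lee_fin.
move=> /(_ aB) H.
rewrite (eq_bigr (fun i : 'I_n => (tau * a i)%:E)); last first.
  by move=> i _; rewrite aE EFinM.
rewrite sumEFin lee_fin -mulr_sumr ler_pdivlMr// /tau mulrAC -!mulrA ler_pM2l//.
rewrite ler_pdivrMl// (le_trans _ H)// mulrC ler_pM2r//.
by rewrite big_ord_recr/= lerDl.
Qed.

End qri.

(** * Powers with exponent at most 1 *)
Section powR_subadditive.
Context {R : realType}.
Implicit Types a b p : R.

Lemma powR_subadd a b p : 0 < p <= 1 -> 0 <= a -> 0 <= b ->
  (a + b) `^ p <= a `^ p + b `^ p.
Proof.
move=> /andP[p0 p1] a0 b0.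
have [ab0|ab0] := eqVneq (a + b) 0.
  by rewrite ab0 powR0 ?gt_eqF// addr_ge0// powR_ge0.
have {}ab0 : 0 < a + b by rewrite lt_neqAle eq_sym ab0 addr_ge0.
(* a quotient in [0, 1] increases when raised to the power p <= 1 *)
have h c : 0 <= c <= a + b -> c / (a + b) * (a + b) `^ p <= c `^ p.
  move=> /andP[]; rewrite le_eqVlt => /predU1P[<-|c0] cab.
    by rewrite mul0r mul0r powR_ge0.
  have -> : c `^ p = (c / (a + b)) `^ p * (a + b) `^ p.
    by rewrite -powRM ?divr_ge0 ?ltW// divfK// gt_eqF.
  rewrite ler_pM2r ?powR_gt0//; apply: ger1_powR => //.
  by rewrite divr_gt0//= ler_pdivrMr// mul1r.
have <- : a / (a + b) * (a + b) `^ p + b / (a + b) * (a + b) `^ p = (a + b) `^ p.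
  by rewrite -mulrDl -mulrDl mulfV ?mul1r// gt_eqF.
by rewrite lerD// h// ?a0 ?b0/= ?lerDl ?lerDr.
Qed.

Lemma powR_distB a b p : 0 < p <= 1 -> `|a| `^ p - `|b| `^ p <= `|a - b| `^ p.
Proof.
move=> p01; have /andP[p0 p1] := p01; rewrite lerBlDr.
apply: (le_trans _ (powR_subadd p01 (normr_ge0 _) (normr_ge0 _))).
apply: ge0_ler_powR; rewrite ?nnegrE ?addr_ge0//; first exact: ltW.
by rewrite -[X in `|X| <= _](subrK b); exact: ler_normD.
Qed.

Lemma powR_invK a p : 0 < p -> 0 <= a -> (a `^ p^-1) `^ p = a.
Proof. by move=> p0 a0; rewrite -powRrM mulVf ?gt_eqF// powRr1. Qed.

Lemma powR_Kinv a p : 0 < p -> 0 <= a -> (a `^ p) `^ p^-1 = a.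
Proof. by move=> p0 a0; rewrite -powRrM mulfV ?gt_eqF// powRr1. Qed.

Lemma poweR_mono (x y : \bar R) p : 0 <= p -> (0 <= x)%E -> (x <= y)%E ->
  (x `^ p <= y `^ p)%E.
Proof.
move=> p0 x0 xy; apply: gt0_ler_poweR => //; rewrite in_itv/= leey andbT//.
exact: (le_trans x0).
Qed.

End powR_subadditive.

Section pow_abs.
Context {R : realType} {d : measure_display} {T : measurableType d}.
Implicit Types f g : T -> R.

Lemma pow_abs_ge0 a f x : 0 <= pow_abs a f x.
Proof. exact: powR_ge0. Qed.

Lemma measurable_pow_abs a f : measurable_fun setT f ->
  measurable_fun setT (pow_abs a f).
Proof.
move=> mf; apply: (measurableT_comp (measurable_powR _)) => //.
exact: measurableT_comp.
Qed.

Lemma pow_abs_indic (a : R) (E : set T) : 0 < a -> pow_abs a \1_E = \1_E.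
Proof.
move=> a0; apply/funext => x; rewrite /pow_abs indicE.
by case: (_ \in _); rewrite ?normr1 ?powR1// normr0 powR0// gt_eqF.
Qed.

End pow_abs.

Section rearr_shift.
Context {R : realType} {d : measure_display} {T : measurableType d}.
Variable mu : {measure set T -> \bar R}.

(** Adding c to the height s of w gives a height whose superlevel set for f is, up
    to a null set, contained in that of w at height s. *)
Lemma rearr_addc (f w : T -> R) (c t : R) : measurable_fun setT f ->
  measurable_fun setT w -> 0 <= c ->
  {ae mu, forall x, `|f x| <= `|w x| + c} ->
  (rearr mu f t <= rearr mu w t + c%:E)%E.
Proof.
move=> mf mw c0 [N [mN N0 hN]].
rewrite -leeBlDr//; apply: le_ereal_inf_tmp => _ [s [s0 ws] <-].
rewrite leeBlDr// -EFinD; apply: rearr_le; first exact: addr_ge0.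
apply: (le_trans _ ws); rewrite /distrib_fun.
apply: (@le_trans _ _ (mu ([set x | s < `|w x|] `|` N))).
  apply: le_measure; rewrite ?inE; first exact: measurable_level.
    by apply: measurableU => //; exact: measurable_level.
  move=> x /= fx; have [Nx|Nx] := pselect (N x); [by right|left => /=].
  have : `|f x| <= `|w x| + c by apply: contrapT => h; apply: Nx; exact: hN.
  by move=> /(lt_le_trans fx); rewrite ltrD2r.
apply: (le_trans (measureU2 _ _ _)) => //; first exact: measurable_level.
by rewrite /= N0 adde0.
Qed.

End rearr_shift.

(** * Functions in L^a + L^oo *)
Section decomposition.
Context {R : realType} {d : measure_display} {T : measurableType d}.
Variable mu : {measure set T -> \bar R}.
Hypothesis mu_div : divisible mu.
Hypothesis mu_inf : mu setT = +oo%E.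
Variables (a : R) (f : T -> R) (h : (T -> R) * (T -> R)).
Hypothesis a01 : 0 < a <= 1.
Hypothesis fh : sum_decomp mu a f h.
Local Notation leb := (@lebesgue_measure R).
Let a0 : 0 < a. Proof. by case/andP: a01. Qed.

Definition decomp_norm1 := fine ('N[mu]_a%:E[EFin \o h.1])%E.
Definition decomp_norm2 := fine ('N[mu]_+oo[EFin \o h.2])%E.
Local Notation n1 := decomp_norm1.
Local Notation n2 := decomp_norm2.

Let mh1 : measurable_fun setT h.1. Proof. by case: fh. Qed.
Let mh2 : measurable_fun setT h.2. Proof. by case: fh. Qed.

Lemma measurable_decomp : measurable_fun setT f.
Proof.
case: fh => _ _ _ _ fE; have -> : f = h.1 \+ h.2 by apply/funext => x; exact: fE.
exact: measurable_funD.
Qed.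

Lemma decomp_norm1E : ('N[mu]_a%:E[EFin \o h.1] = n1%:E)%E.
Proof.
rewrite fineK// ge0_fin_numE; first by case: fh.
exact: Lnorm_ge0.
Qed.

Lemma decomp_norm2E : ('N[mu]_+oo[EFin \o h.2] = n2%:E)%E.
Proof.
rewrite fineK// ge0_fin_numE; first by case: fh.
exact: Lnorm_ge0.
Qed.

Lemma decomp_norm1_ge0 : 0 <= n1. Proof. exact/fine_ge0/Lnorm_ge0. Qed.
Lemma decomp_norm2_ge0 : 0 <= n2. Proof. exact/fine_ge0/Lnorm_ge0. Qed.

Lemma int_decomp1 : (\int[mu]_x (pow_abs a h.1 x)%:E = (n1 `^ a)%:E)%E.
Proof.
rewrite -poweR_EFin -decomp_norm1E poweR_Lnorm ?gt_eqF//.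
Qed.

Lemma ae_decomp2 : {ae mu, forall x, pow_abs a h.2 x <= n2 `^ a}.
Proof.
have := ess_sup_ge mu (abse \o (EFin \o h.2)).
have -> : ess_sup mu (abse \o (EFin \o h.2)) = n2%:E.
  by rewrite -decomp_norm2E unlock /= mu_inf ltry.
apply: filterS => x /=; rewrite lee_fin => hx.
by apply: ge0_ler_powR; rewrite ?nnegrE ?decomp_norm2_ge0 ?(ltW a0).
Qed.

Lemma pow_abs_decomp x : pow_abs a f x <= pow_abs a h.1 x + pow_abs a h.2 x.
Proof.
case: fh => _ _ _ _ fE; rewrite [X in X <= _]/pow_abs fE; apply: (le_trans _ (powR_subadd a01 _ _)) => //.
apply: ge0_ler_powR; rewrite ?nnegrE ?addr_ge0 ?(ltW a0)//.
exact: ler_normD.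
Qed.

(** Chebyshev's inequality. *)
Lemma distrib_pow_abs_lty s : 0 < s -> (distrib_fun mu (pow_abs a h.1) s < +oo)%E.
Proof.
move=> s0; rewrite /distrib_fun.
have mE := measurable_level s (measurable_pow_abs a mh1).
have hE : (s%:E * mu [set x | (s < `|pow_abs a h.1 x|)%R] <= (n1 `^ a)%:E)%E.
  rewrite -integral_cst// -int_decomp1.
  have mp : measurable_fun setT (EFin \o pow_abs a h.1).
    exact/measurable_EFinP/measurable_pow_abs.
  apply: (@le_trans _ _ (\int[mu]_(x in [set x | (s < `|pow_abs a h.1 x|)%R])
     (pow_abs a h.1 x)%:E)%E).
    apply: ge0_le_integral => //.
    - by move=> x _; rewrite lee_fin ltW.
    - exact: measurable_funTS.
    - by move=> x /= /ltW; rewrite lee_fin ger0_norm// pow_abs_ge0.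
  apply: ge0_subset_integral => //.
  by move=> x _; rewrite lee_fin pow_abs_ge0.
rewrite ltey; apply/eqP => E; move: hE.
by rewrite E gt0_muley ?lte_fin// leye_eq.
Qed.

Lemma rearr_decomp t : (rearr mu (pow_abs a f) t <=
  rearr mu (pow_abs a h.1) t + (n2 `^ a)%:E)%E.
Proof.
apply: rearr_addc => //.
- exact/measurable_pow_abs/measurable_decomp.
- exact: measurable_pow_abs.
- exact: powR_ge0.
- apply: filterS ae_decomp2 => x hx.
  rewrite !ger0_norm ?pow_abs_ge0//.
  by rewrite (le_trans (pow_abs_decomp x))// lerD2l.
Qed.

Lemma rearr_decomp_fin t : 0 < t -> rearr mu (pow_abs a f) t \is a fin_num.
Proof.
move=> t0; rewrite ge0_fin_numE ?rearr_ge0//.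
apply: (le_lt_trans (rearr_decomp t)); rewrite lte_add_pinfty ?ltry//.
apply: rearr_lty (distrib_pow_abs_lty ltr01) t0.
exact: measurable_pow_abs.
Qed.

(** Nonnegativity matters because the power of a negative real number is 1 by
    convention. *)
Lemma oscill_decomp_ge0 t : 0 < t -> (0 <= oscill mu (pow_abs a f) t)%E.
Proof.
move=> t0; rewrite /oscill sube_ge0; last by rewrite rearr_decomp_fin ?orbT.
rewrite /rearr_avg -lee_pdivrMl ?invr_gt0// invrK.
have <- : (\int[leb]_(s in `]0%R, t[) cst (rearr mu (pow_abs a f) t) s =
    t%:E * rearr mu (pow_abs a f) t)%E.
  by rewrite integral_cst//= lebesgue_measure_itv/= lte_fin t0 oppr0 adde0 muleC.
apply: ge0_le_integral => //.
- by move=> s _; exact: rearr_ge0.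
- exact: measurable_rearr.
- by move=> s /=; rewrite in_itv/= => /andP[_ /ltW]; exact: rearr_anti.
Qed.

(** The oscillation is at most the average of g* over (0, t), where g = |f|^a is
    at most |h.1|^a + n2^a almost everywhere. *)
Lemma oscill_decomp t : 0 < t -> t <= 1 ->
  (oscill mu (pow_abs a f) t `^ a^-1 <= (((2 / t) `^ a^-1) * (n1 + n2))%:E)%E.
Proof.
move=> t0 t1.
have n10 := decomp_norm1_ge0; have n20 := decomp_norm2_ge0.
have ho : (oscill mu (pow_abs a f) t <= ((2 / t) * (n1 + n2) `^ a)%:E)%E.
  apply: (@le_trans _ _ (rearr_avg mu (pow_abs a f) t)).
    by rewrite leeBlDr ?rearr_decomp_fin// leeDl// rearr_ge0.
  rewrite /rearr_avg mulrC mulrA EFinM mulrC muleC lee_pmul2r ?lte_fin ?invr_gt0//.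
  apply: (@le_trans _ _ (\int[leb]_(s in `]0%R, t[)
      (rearr mu (pow_abs a h.1) s + (n2 `^ a)%:E)))%E.
    apply: ge0_le_integral => //.
    - by move=> s _; exact: rearr_ge0.
    - exact: measurable_rearr.
    - by apply: emeasurable_funD => //; exact: measurable_rearr.
    - by move=> s _; exact: rearr_decomp.
  rewrite ge0_integralD//; last 3 first.
  - by move=> s _; exact: rearr_ge0.
  - exact: measurable_rearr.
  - by move=> s _; rewrite lee_fin powR_ge0.
  rewrite integral_cst//= lebesgue_measure_itv/= lte_fin t0 oppr0 adde0 -EFinM.
  have := int_rearr_le_integral mu_div mu_inf (measurable_pow_abs a mh1)
    (pow_abs_ge0 a h.1) distrib_pow_abs_lty t0.
  rewrite int_decomp1 => h1.
  apply: (le_trans (leeD h1 (lexx _))); rewrite -EFinD lee_fin.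
  rewrite mulr_natl mulr2n; apply: lerD.
    by apply: ge0_ler_powR; rewrite ?nnegrE ?addr_ge0 ?(ltW a0)// lerDl.
  apply: (@le_trans _ _ (n2 `^ a)); first by rewrite ler_piMr ?powR_ge0.
  by apply: ge0_ler_powR; rewrite ?nnegrE ?addr_ge0 ?(ltW a0)// lerDr.
have o0 := oscill_decomp_ge0 t0.
apply: (le_trans (poweR_mono _ o0 ho)); first by rewrite invr_ge0 ltW.
rewrite poweR_EFin powRM ?powR_ge0 ?(divr_ge0 _ (ltW t0))//.
by rewrite powR_Kinv ?addr_ge0.
Qed.

End decomposition.

(** * The fundamental function *)
Section fundamental_function.
Context {R : realType} {d : measure_display} {T : measurableType d}.
Variable mu : {measure set T -> \bar R}.
Hypothesis mu_div : divisible mu.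
Hypothesis mu_inf : mu setT = +oo%E.

Lemma fundamentalE (N : (T -> R) -> \bar R) (t : R) : 0 <= t ->
  exists E, [/\ measurable E, mu E = t%:E & fundamental mu N t = N \1_E].
Proof.
move=> t0; have [|E [mE _ muE]] := mu_div measurableT t0.
  by rewrite mu_inf leey.
have : [set N \1_E | E in [set E : set T | measurable E /\ mu E = t%:E]] (fundamental mu N t).
  by apply: (@xgetPex _ 0%E); exists (N \1_E); exists E.
by move=> [F [mF muF] NF]; exists F; split.
Qed.

Lemma fundamental_ge0 (N : (T -> R) -> \bar R) (t : R) :
  (forall E : set T, (0 <= N \1_E)%E) -> (0 <= fundamental mu N t)%E.
Proof. by move=> N0; rewrite /fundamental; case: xgetP => // _ -> [E _ <-]. Qed.

Variable X : qri_space mu.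

Lemma convex_norm_car (a : R) (u : T -> R) : qri_car X (pow_abs a u) ->
  convex_norm X a u = ((qri_norm X (pow_abs a u)) `^ a^-1)%:E.
Proof.
by move=> Xu; rewrite /convex_norm /xnorm; case: pselect => // _; rewrite poweR_EFin.
Qed.

Lemma convex_norm_notin (a : R) (u : T -> R) : 0 < a ->
  ~ qri_car X (pow_abs a u) -> convex_norm X a u = +oo%E.
Proof.
move=> a0 Xu; rewrite /convex_norm /xnorm.
case: pselect => [Xu'|nXu] /=; first by have := Xu Xu'.
by rewrite invr_eq0 gt_eqF.
Qed.

Lemma convex_norm_indic (a : R) (E : set T) : 0 < a -> measurable E ->
  (mu E < +oo)%E -> convex_norm X a \1_E = ((qri_norm X \1_E) `^ a^-1)%:E.
Proof.
move=> a0 mE Efin; rewrite convex_norm_car pow_abs_indic//; exact: qri_indic.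
Qed.

(** A set of measure t is found inside a set of measure 1 whose indicator has norm 1
    by normalization. *)
Lemma fundamental_le1 (a t : R) : 0 < a -> normalized X -> 0 <= t <= 1 ->
  (fundamental mu (convex_norm X a) t <= 1)%E.
Proof.
move=> a0 nX /andP[t0 t1].
have [E1 [mE1 muE1]] := fundamentalE (xnorm X) ler01.
rewrite -/(fundamental mu (xnorm X)) nX => XE1.
have E1fin : (mu E1 < +oo)%E by rewrite muE1 ltry.
have XE : qri_car X \1_E1 by exact: qri_indic.
have nE1 : qri_norm X \1_E1 = 1.
  by move: XE1; rewrite /xnorm; case: pselect => // _ [].
have [|F [mF FE muF]] := mu_div mE1 t0; first by rewrite muE1 lee_fin.
have [E [mE muE ->]] := fundamentalE (convex_norm X a) t0.
have Efin : (mu E < +oo)%E by rewrite muE ltry.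
rewrite convex_norm_indic// lee_fin.
rewrite (@qri_norm_indic_eq _ _ _ _ X E F)//; last by rewrite muE muF.
have [|x|XF nF] := @qri_mono _ _ _ _ X \1_F \1_E1 XE; first exact: measurable_indic.
  rewrite !indicE; case: (boolP (x \in F)) => [/set_mem/FE xE|_].
    by rewrite mem_set// ler01 lexx.
  by rewrite lexx ler0n.
rewrite [leRHS](_ : 1 = 1 `^ a^-1); last by rewrite powR1.
apply: ge0_ler_powR.
- by rewrite invr_ge0 ltW.
- by rewrite nnegrE qri_ge0.
- by rewrite nnegrE.
- by rewrite -nE1.
Qed.

End fundamental_function.

(** * Oscillation and modulus of continuity *)
Section oscillation.
Context {R : realType} {d : measure_display} {T : metricMeasurableType R d}.
Variable mu : {measure set T -> \bar R}.
Hypothesis T_borel : borel_space T.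
Hypothesis mu_doubling : doubling_measure mu.
Hypothesis mu_div : divisible mu.
Hypothesis mu_inf : mu setT = +oo%E.
Variables (a : R) (f : T -> R).
Hypothesis a01 : 0 < a <= 1.
Let a0 : 0 < a. Proof. by case/andP: a01. Qed.
Hypothesis f_sum : sum_space mu a f.
Local Notation leb := (@lebesgue_measure R).
Local Notation g := (pow_abs a f).

Let mf : measurable_fun setT f.
Proof. by have [h fh] := f_sum; exact: (measurable_decomp fh). Qed.

Let mg : measurable_fun setT g. Proof. exact: measurable_pow_abs. Qed.

Lemma nabla_pow r x : pow_abs a (nabla mu a r f) x =
  (fine (mu (ball x r)))^-1 * \int[mu]_(y in ball x r) (`|f x - f y| `^ a).
Proof.
have h0 : 0 <= (fine (mu (ball x r)))^-1 * \int[mu]_(y in ball x r) (`|f x - f y| `^ a).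
  apply: mulr_ge0; first by rewrite invr_ge0 fine_ge0.
  by apply: Rintegral_ge0 => y _; exact: powR_ge0.
by rewrite /pow_abs ger0_norm ?powR_ge0// /nabla powR_invK.
Qed.

Lemma measurable_increment x : measurable_fun setT (fun y => `|f x - f y| `^ a).
Proof.
apply: (measurableT_comp (measurable_powR _)) => //.
apply: measurableT_comp => //; exact: measurable_funB.
Qed.

Lemma measurable_increment_EFin D x :
  measurable_fun D (fun y => (`|f x - f y| `^ a)%:E).
Proof.
apply: (measurable_comp measurableT) => //.
exact: measurable_funS (measurable_increment x).
Qed.

(** The modulus uses the finite part of this integral, which would be 0 if the
    integral were infinite. *)
Lemma increment_integral_lty r x : 0 < r ->
  (\int[mu]_(y in ball x r) (`|f x - f y| `^ a)%:E < +oo)%E.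
Proof.
move=> r0; have [h fh] := f_sum.
have mB : measurable (ball x r) by exact: measurable_mball.
have mh1 : measurable_fun setT (pow_abs a h.1).
  by apply: measurable_pow_abs; case: fh.
pose K := g x + decomp_norm2 mu h `^ a.
have K0 : 0 <= K by rewrite addr_ge0// powR_ge0.
apply: (@le_lt_trans _ _ (\int[mu]_(y in ball x r) (K%:E + (pow_abs a h.1 y)%:E))%E).
  apply: ae_ge0_le_integral => //.
  - exact: measurable_increment_EFin.
  - by move=> y _; rewrite -EFinD lee_fin addr_ge0// pow_abs_ge0.
  - apply: emeasurable_funD => //; apply/measurable_EFinP.
    exact: measurable_funTS.
  - apply: filterS (ae_decomp2 mu_inf a01 fh) => y hy _.
    rewrite -EFinD lee_fin /K.
    apply: (@le_trans _ _ (g x + g y)).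
      apply: (le_trans _ (powR_subadd a01 _ _)) => //.
      apply: ge0_ler_powR; rewrite ?nnegrE ?addr_ge0 ?(ltW a0)//.
      exact: ler_normB.
    rewrite -addrA lerD2l (le_trans (pow_abs_decomp a01 fh y))//.
    by rewrite [leRHS]addrC lerD2l.
rewrite ge0_integralD//; last 2 first.
- by move=> y _; rewrite lee_fin pow_abs_ge0.
- exact/measurable_EFinP/measurable_funTS.
rewrite integral_cst// lte_add_pinfty//.
  by rewrite lte_mul_pinfty ?lee_fin// mu_ball_lty.
apply: (@le_lt_trans _ _ (\int[mu]_y (pow_abs a h.1 y)%:E)%E).
  apply: ge0_subset_integral => //; first exact/measurable_EFinP.
  by move=> y _; rewrite lee_fin pow_abs_ge0.
by rewrite (int_decomp1 a01 fh) ltry.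
Qed.

(** At least half of the ball lies where g <= c, and there |f(x) - f(y)|^a is at
    least g(x) - g(y) >= g(x) - c. *)
Lemma nabla_lower r t c x : 0 < r -> 0 < t -> ((2 * t)%:E <= mu (ball x r))%E ->
  (mu [set y | (c < g y)%R] <= t%:E)%E ->
  Num.max 0 (g x - c) <= 2 * pow_abs a (nabla mu a r f) x.
Proof.
move=> r0 t0 tB gc; rewrite ge_max mulr_ge0 ?pow_abs_ge0//=.
have [gxc|cgx] := leP (g x) c.
  by rewrite (@le_trans _ _ 0)// ?subr_le0// mulr_ge0 ?pow_abs_ge0.
rewrite nabla_pow.
have mB : measurable (ball x r) by exact: measurable_mball.
have mL : measurable [set y | c < g y].
  have := measurable_level c mg.
  by under eq_set do rewrite ger0_norm ?pow_abs_ge0//.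
pose L := [set y | c < g y]; pose m := fine (mu (ball x r)).
have mE : mu (ball x r) = m%:E by rewrite fineK// mu_ball_fin.
have tm : 2 * t <= m by move: tB; rewrite mE lee_fin.
have m0 : 0 < m by rewrite (lt_le_trans _ tm)// mulr_gt0.
have muBL : ((m - t)%:E <= mu (ball x r `\` L))%E.
  rewrite EFinB leeBlDr// -mE (measureDI mu mB mL) leeD//.
  apply: (le_trans _ gc); apply: le_measure; rewrite ?inE//.
  exact: measurableI.
have hI : (((g x - c) * (m - t))%:E <= \int[mu]_(y in ball x r) (`|f x - f y| `^ a)%:E)%E.
  apply: (@le_trans _ _ (\int[mu]_(y in ball x r `\` L) (g x - c)%:E)%E).
    rewrite integral_cst//; last exact: measurableD.
    by rewrite EFinM lee_pmul2l// lte_fin subr_gt0.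
  apply: (@le_trans _ _ (\int[mu]_(y in ball x r `\` L) (`|f x - f y| `^ a)%:E)%E).
    apply: ge0_le_integral => //.
    - exact: measurableD.
    - by move=> y _; rewrite lee_fin subr_ge0 ltW.
    - exact: measurable_increment_EFin.
    - move=> y [_ /= /negP]; rewrite -leNgt => gy; rewrite lee_fin.
      by rewrite (le_trans _ (powR_distB _ _ a01))// lerD2l lerN2.
  apply: ge0_subset_integral => //; first exact: measurableD.
    exact: measurable_increment_EFin.
have : (g x - c) * (m - t) <= \int[mu]_(y in ball x r) (`|f x - f y| `^ a).
  rewrite -lee_fin (le_trans hI)// /Rintegral fineK//.
  rewrite ge0_fin_numE ?increment_integral_lty//.
  by apply: integral_ge0 => y _; rewrite lee_fin powR_ge0.
set I := Rintegral _ _ _ => hI'.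
rewrite -/m mulrCA -ler_pdivrMl ?invr_gt0// invrK.
apply: (le_trans _ (ler_wpM2l _ hI')) => //.
rewrite mulrCA [leLHS]mulrC ler_wpM2l ?subr_ge0 ?(ltW cgx)//.
by rewrite mulrBr; lra.
Qed.

(** With c = g*(t) and v = (g - c)_+, the inequality g <= v + c gives g* <= v* + c,
    so O(g, t) is at most the average of v* over (0, t); [ri_int_rearr] applies
    to v, and [nabla_lower] bounds v by twice the power of the gradient. *)
Lemma oscill_modulus (X : qri_space mu) (r t : R) : is_ri X -> 0 < r -> 0 < t ->
  (forall x, (2 * t)%:E <= mu (ball x r))%E ->
  (oscill mu g t `^ a^-1 * fundamental mu (convex_norm X a) t
    <= (2 `^ a^-1)%:E * modulus X a f r)%E.
Proof.
move=> riX r0 t0 tB; rewrite /modulus.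
have [Xh|Xh] := pselect (qri_car X (pow_abs a (nabla mu a r f))); last first.
  by rewrite convex_norm_notin// gt0_muley ?leey// lte_fin powR_gt0.
rewrite convex_norm_car//.
have [h fh] := f_sum.
have fing : rearr mu g t \is a fin_num by exact: (rearr_decomp_fin mu_inf a01 fh).
pose c := fine (rearr mu g t).
have c0 : 0 <= c by rewrite fine_ge0// rearr_ge0.
have gc : (mu [set y | (c < g y)%R] <= t%:E)%E.
  have := @distrib_rearr _ _ _ mu g c t mg.
  rewrite fineK// => /(_ (lexx _)); rewrite /distrib_fun.
  by under eq_set do rewrite ger0_norm ?pow_abs_ge0//.
pose v x := Num.max 0 (g x - c).
have v0 x : 0 <= v x by rewrite le_max lexx.
have mv : measurable_fun setT v.
  by apply: measurable_maxr => //; exact: measurable_funB.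
have [Xv nv] : qri_car X v /\ qri_norm X v <= 2 * qri_norm X (pow_abs a (nabla mu a r f)).
  rewrite -[X in X * _]ger0_norm// -qri_homo//; apply: qri_mono => //.
    exact: qri_scale.
  by move=> x; rewrite v0 /=; exact: (nabla_lower r0 t0).
have vfin s : 0 < s -> (distrib_fun mu v s < +oo)%E.
  move=> s0; apply: (@le_lt_trans _ _ t%:E); last exact: ltry.
  apply: (le_trans _ gc); apply: le_measure; rewrite ?inE.
  - exact: measurable_level.
  - have := measurable_level c mg.
    by under eq_set do rewrite ger0_norm ?pow_abs_ge0//.
  - move=> x /=; rewrite ger0_norm// /v lt_max => /orP[|].
      by rewrite ltNge (ltW s0).
    by move=> /(lt_trans s0); rewrite subr_gt0.
have [E [mE muE ->]] := fundamentalE mu_div mu_inf (convex_norm X a) (ltW t0).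
have Efin : (mu E < +oo)%E by rewrite muE ltry.
rewrite convex_norm_indic//.
have XE : qri_car X \1_E by exact: qri_indic.
have hv := ri_int_rearr riX mu_div mu_inf t0 mE muE Xv v0 vfin.
have ho : (oscill mu g t <= (t^-1)%:E * \int[leb]_(s in `]0%R, t[) rearr mu v s)%E.
  rewrite leeBlDr// -[X in (_ <= _ + X)%E](fineK fing) -/c.
  have -> : c%:E = ((t^-1)%:E * (c%:E * t%:E))%E.
    by rewrite -!EFinM mulrCA mulVf ?gt_eqF// mulr1.
  have <- : (\int[leb]_(s in `]0%R, t[) c%:E = c%:E * t%:E)%E.
    by rewrite integral_cst//= lebesgue_measure_itv/= lte_fin t0 oppr0 adde0.
  rewrite -ge0_muleDr; last 2 first.
  - by apply: integral_ge0 => s _; exact: rearr_ge0.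
  - by apply: integral_ge0.
  rewrite lee_pmul2l ?lte_fin ?invr_gt0//.
  rewrite -ge0_integralD//; last 2 first.
  - by move=> s _; exact: rearr_ge0.
  - exact: measurable_rearr.
  apply: ge0_le_integral => //.
  - by move=> s _; exact: rearr_ge0.
  - exact: measurable_rearr.
  - by apply: emeasurable_funD => //; exact: measurable_rearr.
  - move=> s _; apply: rearr_addc => //; apply: aeW => x.
    by rewrite !ger0_norm ?pow_abs_ge0// -lerBlDr le_max lexx orbT.
have o0 := oscill_decomp_ge0 mu_inf a01 fh t0.
have n0 : 0 <= qri_norm X \1_E by exact: qri_ge0.
have ho2 : (oscill mu g t * (qri_norm X \1_E)%:E
    <= (2 * qri_norm X (pow_abs a (nabla mu a r f)))%:E)%E.
  apply: (le_trans (lee_wpmul2r _ ho)); first by rewrite lee_fin.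
  rewrite -muleA lee_pdivrMl//; apply: (le_trans hv).
  by rewrite -EFinM lee_fin ler_pM2l.
have ai0 : 0 <= a^-1 by rewrite invr_ge0 ltW.
have := poweR_mono ai0 _ ho2; rewrite mule_ge0 ?lee_fin// => /(_ isT) hh.
rewrite -poweR_EFin -poweRM//; apply: (le_trans hh).
by rewrite poweR_EFin -EFinM powRM// qri_ge0.
Qed.

Lemma oscill_crude (X : qri_space mu) (t : R) : normalized X -> 0 < t <= 1 ->
  (oscill mu g t `^ a^-1 * fundamental mu (convex_norm X a) t
    <= ((2 / t) `^ a^-1)%:E * sum_norm mu a f)%E.
Proof.
move=> nX /andP[t0 t1].
have p0 : 0 < (2 / t) `^ a^-1 by rewrite powR_gt0// divr_gt0.
rewrite -lee_pdivrMl//; apply: le_ereal_inf_tmp => _ [h fh <-].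
rewrite lee_pdivrMl// (decomp_norm1E fh) (decomp_norm2E fh) -EFinD -EFinM.
rewrite -[leRHS]mule1; apply: lee_pmul.
- exact: poweR_ge0.
- have [E [mE muE ->]] := fundamentalE mu_div mu_inf (convex_norm X a) (ltW t0).
  exact: poweR_ge0.
- exact: (oscill_decomp mu_div mu_inf a01 fh).
- by apply: fundamental_le1 => //; rewrite (ltW t0).
Qed.

End oscillation.

(** * Comparison of integrals through step functions *)
Section step_bounds.
Context {R : realType} {d : measure_display} {T : measurableType d}.
Variable mu : {measure set T -> \bar R}.
Local Open Scope ereal_scope.

(** The integral of a nonnegative function is a supremum over simple functions
    below it, hence monotone for arbitrary functions.  The Besov seminorm calls
    for this generality: nothing makes the modulus measurable in r. *)
Lemma le_integral_nonmeasurable (D : set T) (f1 f2 : T -> \bar R) :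
  (forall x, D x -> 0 <= f1 x) -> (forall x, D x -> f1 x <= f2 x) ->
  \int[mu]_(x in D) f1 x <= \int[mu]_(x in D) f2 x.
Proof.
move=> f10 f12; have f20 x : D x -> 0 <= f2 x.
  by move=> Dx; exact: le_trans (f10 x Dx) (f12 x Dx).
rewrite !ge0_integralE//; apply: ge_ereal_sup => _ [h /= hf <-].
apply: ereal_sup_ubound; exists h => //= x.
by apply: (le_trans (hf x)); exact: lee_restrict.
Qed.

Variables (D_ : nat -> set T) (m_ : nat -> \bar R).
Hypothesis mD_ : forall j, measurable (D_ j).
Hypothesis m0_ : forall j, 0 <= m_ j.

Let step j x := m_ j * (\1_(D_ j) x)%:E.

Let step0 j x : 0 <= step j x. Proof. by rewrite mule_ge0// lee_fin. Qed.

Let mstep j A : measurable A -> measurable_fun A (step j).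
Proof.
move=> mA; apply: emeasurable_funM => //.
by apply/measurable_EFinP; exact: measurable_indic.
Qed.

Let mstep_sum A : measurable A -> measurable_fun A (fun x => \sum_(j <oo) step j x).
Proof.
move=> mA; apply: ge0_emeasurable_sum => //.
by move=> j _; exact: mstep.
Qed.

Let int_step A j : measurable A -> D_ j `<=` A ->
  \int[mu]_(x in A) step j x = m_ j * mu (D_ j).
Proof.
move=> mA DA; rewrite /step ge0_integralZl//; last first.
  by apply/measurable_EFinP; exact: measurable_indic.
by rewrite integral_indic//; congr (_ * mu _); exact/setIidPl.
Qed.

(** On disjoint sets D_j the step function with values m_j lies below G. *)
Lemma step_lower_bound (D : set T) (G : T -> \bar R) : measurable D ->
  trivIset setT D_ -> (forall j, D_ j `<=` D) ->
  (forall x, D x -> 0 <= G x) -> (forall j x, D_ j x -> m_ j <= G x) ->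
  \sum_(j <oo) m_ j * mu (D_ j) <= \int[mu]_(x in D) G x.
Proof.
move=> mD tD DD G0 mG.
have -> : \sum_(j <oo) m_ j * mu (D_ j) = \int[mu]_(x in D) (\sum_(j <oo) step j x).
  rewrite integral_nneseries//; last by move=> j; exact: mstep.
  by apply: eq_eseriesr => j _; rewrite int_step.
apply: le_integral_nonmeasurable => x Dx; first exact: nneseries_ge0.
apply: lime_le; first exact: is_cvg_nneseries.
apply: nearW => n; rewrite big_mkord.
have [[i Dix]|nD] := pselect (exists i : 'I_n, D_ i x); last first.
  rewrite big1 ?G0// => i _; rewrite /step indicE memNset ?mule0// => Di.
  by apply: nD; exists i.
rewrite (bigD1 i)//= big1 ?adde0.
  by rewrite /step indicE mem_set// mule1; exact: mG Dix.
move=> j ji; rewrite /step indicE memNset ?mule0// => Dj.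
move/eqP: ji; apply; apply/val_inj; apply: tD => //.
by exists x.
Qed.

(** F lies below the sum of the step functions; the D_j may overlap, and A covers
    what they leave out. *)
Lemma step_upper_bound (D A : set T) (mA : \bar R) (F : T -> \bar R) :
  measurable D -> measurable A -> 0 <= mA ->
  D `<=` A `|` \bigcup_j D_ j ->
  (forall x, D x -> 0 <= F x) ->
  (forall x, D x -> A x -> F x <= mA) ->
  (forall j x, D x -> D_ j x -> F x <= m_ j) ->
  \int[mu]_(x in D) F x <= mA * mu A + \sum_(j <oo) m_ j * mu (D_ j).
Proof.
move=> mD mmA mA0 DD F0 FA FD.
have mi : measurable_fun setT (fun x => (\1_A x)%:E : \bar R).
  by apply/measurable_EFinP; exact: measurable_indic.
have -> : \sum_(j <oo) m_ j * mu (D_ j) = \int[mu]_x (\sum_(j <oo) step j x).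
  rewrite integral_nneseries//; last by move=> j; exact: mstep.
  by apply: eq_eseriesr => j _; rewrite int_step.
have -> : mA * mu A = \int[mu]_x (mA * (\1_A x)%:E).
  by rewrite ge0_integralZl// integral_indic// setIT.
rewrite -ge0_integralD//; last 4 first.
- by move=> x _; rewrite mule_ge0// lee_fin.
- exact: emeasurable_funM.
- by move=> x _; exact: nneseries_ge0.
- exact: mstep_sum.
apply: (@le_trans _ _ (\int[mu]_(x in D) (mA * (\1_A x)%:E + \sum_(j <oo) step j x))).
  apply: le_integral_nonmeasurable => // x Dx.
  have [Ax|[j _ Dj]] := DD x Dx.
    rewrite indicE mem_set// mule1 (le_trans (FA _ Dx Ax))// leeDl//.
    exact: nneseries_ge0.
  apply: (@le_trans _ _ (\sum_(j <oo) step j x)); last first.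
    by rewrite leeDr// mule_ge0// lee_fin.
  apply: (le_trans (FD _ _ Dx Dj)).
  have <- : step j x = m_ j by rewrite /step indicE mem_set// mule1.
  by rewrite (@nneseriesD1 _ (step ^~ x) j)// leeDl//; exact: nneseries_ge0.
apply: ge0_subset_integral => //.
- apply: emeasurable_funD; last exact: mstep_sum.
  exact: emeasurable_funM.
- move=> x _; apply: adde_ge0; first by rewrite mule_ge0// lee_fin.
  exact: nneseries_ge0.
Qed.

End step_bounds.

(** * Geometric blocks and L^q norms for dt/t *)
Section geometric_blocks.
Context {R : realType}.
Variables (C t0 : R).
Hypothesis C1 : 1 < C.
Hypothesis t00 : 0 < t0.

(** Blocks of times t and of radii r.  They are used with C = 2^Q, and then t^(1/Q)
    and r are comparable on blocks with the same index. *)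
Definition source_block j : set R := `[t0 / C ^+ j.+1, t0 / C ^+ j[%classic.
Definition target_block j : set R := `[(2 ^+ j)^-1, 2 * (2 ^+ j)^-1[%classic.

Let C0 : 0 < C. Proof. exact: lt_trans C1. Qed.

(** Bernoulli's inequality bounds C^n from below, so the lower ends t0 / C^(j+1)
    tend to 0; the block is the one with the first lower end below t. *)
Lemma source_block_cover t : 0 < t < t0 -> exists j, source_block j t.
Proof.
move=> /andP[tp tt0].
have ex : exists j, t0 / C ^+ j.+1 <= t.
  have [n hn] : exists n : nat, t0 / t <= 1 + n%:R * (C - 1).
    exists (Num.truncn (t0 / t / (C - 1))).+1.
    rewrite -lerBlDl -ler_pdivrMr ?subr_gt0//.
    apply: (le_trans _ (ltW (truncnS_gt _))); rewrite ler_pM2r ?invr_gt0 ?subr_gt0//.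
    by rewrite lerBlDr lerDl.
  exists n; rewrite ler_pdivrMr ?exprn_gt0// mulrC -ler_pdivrMr//.
  apply: (le_trans hn).
  have bern k : 1 + k%:R * (C - 1) <= C ^+ k.
    elim: k => [|k IH]; first by rewrite mul0r addr0 expr0.
    rewrite exprS (@le_trans _ _ (C * (1 + k%:R * (C - 1))))//; last by rewrite ler_pM2l.
    rewrite -natr1 -subr_ge0.
    have -> : C * (1 + k%:R * (C - 1)) - (1 + (k%:R + 1) * (C - 1)) = k%:R * (C - 1) ^+ 2 by ring.
    by rewrite mulr_ge0// sqr_ge0.
  apply: (le_trans (bern n)); rewrite exprS ler_peMl ?exprn_ge0// ltW//.
have [j hj jmin] := ex_minnP ex.
exists j; rewrite /source_block /= in_itv/= hj /=.
case: j hj jmin => [|j] hj jmin; first by rewrite expr0 divr1.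
by rewrite ltNge; apply/negP => /jmin; rewrite ltnn.
Qed.

Lemma source_block_gt0 j t : source_block j t -> 0 < t.
Proof.
rewrite /source_block /= in_itv/= => /andP[+ _]; apply: lt_le_trans.
by rewrite divr_gt0// exprn_gt0.
Qed.

Lemma measure_source_block j :
  (@lebesgue_measure R (source_block j) = (t0 / C ^+ j.+1 * (C - 1))%:E)%E.
Proof.
rewrite lebesgue_measure_itv/= lte_fin ltr_pM2l// ltf_pV2 ?posrE ?exprn_gt0//.
rewrite ltr_eXn2l// ltnSn -EFinB; congr EFin.
rewrite mulrBr mulr1; congr (_ - _).
by rewrite exprSr invfM mulrA divfK// gt_eqF.
Qed.

Lemma measure_target_block j :
  (@lebesgue_measure R (target_block j) = ((2 ^+ j)^-1)%:E)%E.
Proof.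
have h : 0 < (2 ^+ j)^-1 :> R by rewrite invr_gt0 exprn_gt0.
rewrite lebesgue_measure_itv/= lte_fin ltr_pMl// ltr1n -EFinB; congr EFin.
by rewrite mulr2n mulrDl mul1r addrK.
Qed.

Lemma trivIset_target_block : trivIset setT target_block.
Proof.
have h i j rho : (i < j)%N -> target_block i rho -> target_block j rho -> False.
  rewrite /target_block /= !in_itv/= => ij /andP[h1 _] /andP[_ h2].
  have : (2 ^+ i)^-1 < 2 * (2 ^+ j)^-1 :> R by exact: le_lt_trans h2.
  apply/negP; rewrite -leNgt -(subnK ij) exprD exprS invfM [_^-1 * (2 * _)^-1]mulrC.
  rewrite !invfM mulrA mulrA mulfV// mul1r ler_piMr ?invr_ge0 ?exprn_ge0//.
  by rewrite invf_le1 ?exprn_gt0// exprn_ege1// ler1n.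
move=> i j _ _ [x [xi xj]]; have [ij|ij|//] := ltngtP i j.
  by have := h _ _ _ ij xi xj.
by have := h _ _ _ ij xj xi.
Qed.

End geometric_blocks.

Section Lq_comparison.
Context {R : realType}.
Variables (C t0 K0 K1 : R).
Hypothesis C1 : 1 < C.
Hypothesis t001 : 0 < t0 <= 1.
Hypothesis K00 : 0 < K0.
Hypothesis K10 : 0 < K1.
Local Open Scope ereal_scope.
Local Notation leb := (@lebesgue_measure R).

(** The situation that noncollapsing produces: F is the integrand on the left of
    the estimate, G the one of the Besov seminorm, and S the norm of f in
    L^alpha + L^oo. *)
Definition block_dominated (F G : R -> \bar R) (S : \bar R) : Prop :=
  [/\ forall t, 0 <= F t, forall r, 0 <= G r, 0 <= S,
      forall j t r, source_block C t0 j t -> target_block j r ->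
        F t <= K0%:E * G r &
      forall t, (t0 <= t < 1)%R -> F t <= K1%:E * S].

Let C0 : (0 < C)%R. Proof. exact: lt_trans C1. Qed.
Let t00 : (0 < t0)%R. Proof. by case/andP: t001. Qed.

(** Let b_j be the infimum of G over the j-th target block.  Then F <= K0 b_j on
    the j-th source block, whose measure is C - 1 times its lower end, and
    G >= b_j on the j-th target block, whose measure is half of its upper end.
    Hence both integrals compare with the sum of the b_j^p. *)
Lemma Lq_compare_fin (p : R) : (0 < p)%R -> exists2 K : R, (0 < K)%R &
  forall F G S, block_dominated F G S ->
    Lq_dt_t p%:E `]0%R, 1%R[ F <= K%:E * (Lq_dt_t p%:E `]0%R, +oo[ G + S).
Proof.
move=> p0.
pose A := ((2 * (C - 1)) * K0 `^ p + K1 `^ p / t0)%R.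
have A0 : (0 < A)%R.
  by rewrite addr_gt0 ?mulr_gt0 ?powR_gt0 ?subr_gt0 ?invr_gt0.
exists (A `^ p^-1)%R; first by rewrite powR_gt0.
move=> F G S [F0 G0 S0 FG FS] /=.
set I := integral _ _ _; set J := integral _ _ _.
have pi0 : (0 <= p^-1)%R by rewrite invr_ge0 ltW.
have I0 : 0 <= I.
  apply: integral_ge0 => t /=; rewrite in_itv/= => /andP[tp _].
  by rewrite mule_ge0 ?poweR_ge0// lee_fin invr_ge0 ltW.
have J0 : 0 <= J.
  apply: integral_ge0 => t /=; rewrite in_itv/= andbT => tp.
  by rewrite mule_ge0 ?poweR_ge0// lee_fin invr_ge0 ltW.
suff IJ : I <= A%:E * (J `^ p^-1 + S) `^ p.
  have L0 : 0 <= J `^ p^-1 + S by rewrite adde_ge0 ?poweR_ge0.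
  apply: (le_trans (poweR_mono pi0 I0 IJ)).
  rewrite poweRM ?poweR_ge0 ?lee_fin ?(ltW A0)// poweR_EFin.
  by rewrite -poweRrM mulfV ?gt_eqF// poweRe1.
pose b j := ereal_inf [set G r | r in target_block j].
have b0 j : 0 <= b j by apply: le_ereal_inf_tmp => _ [r _ <-].
have Fb j t : source_block C t0 j t -> F t <= K0%:E * b j.
  move=> tj; rewrite -lee_pdivrMl//; apply: le_ereal_inf_tmp => _ [r rj <-].
  by rewrite lee_pdivrMl//; exact: FG tj rj.
have hJ : \sum_(j <oo) (b j `^ p * 2^-1%:E) <= J.
  pose m j := b j `^ p * (2 * (2 ^+ j)^-1)^-1%:E.
  have m0 j : 0 <= m j.
    by rewrite mule_ge0 ?poweR_ge0// lee_fin invr_ge0 mulr_ge0// invr_ge0 exprn_ge0.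
  have -> : \sum_(j <oo) (b j `^ p * 2^-1%:E) = \sum_(j <oo) m j * leb (target_block j).
    apply: eq_eseriesr => j _; rewrite [leb _]measure_target_block /m -muleA -EFinM.
    by rewrite invfM invrK -mulrA mulfV ?mulr1// expf_neq0.
  apply: step_lower_bound => //.
  - by move=> j; exact: measurable_itv.
  - exact: trivIset_target_block.
  - move=> j r; rewrite /target_block /= !in_itv/= andbT => /andP[+ _].
    by apply: lt_le_trans; rewrite invr_gt0 exprn_gt0.
  - move=> r /=; rewrite in_itv/= andbT => rp.
    by rewrite mule_ge0 ?poweR_ge0// lee_fin invr_ge0 ltW.
  - move=> j r rj; rewrite /m; apply: lee_pmul.
    + exact: poweR_ge0.
    + by rewrite lee_fin invr_ge0 mulr_ge0// invr_ge0 exprn_ge0.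
    + by apply: poweR_mono => //; [exact: ltW|apply: ereal_inf_lbound; exists r].
    + move: rj; rewrite /target_block /= in_itv/= => /andP[r1 r2].
      have r0 : (0 < r)%R by rewrite (lt_le_trans _ r1)// invr_gt0 exprn_gt0.
      have r2' : (0 < 2 * (2 ^+ j)^-1 :> R)%R by rewrite mulr_gt0// invr_gt0 exprn_gt0.
      by rewrite lee_fin lef_pV2 ?posrE// ltW.
have hI : I <= (K1%:E * S) `^ p * (t0^-1)%:E * leb `[t0, 1%R[ +
    \sum_(j <oo) ((K0%:E * b j) `^ p * ((t0 / C ^+ j.+1)^-1)%:E) * leb (source_block C t0 j).
  apply: step_upper_bound => //.
  - by move=> j; exact: measurable_itv.
  - move=> j; rewrite mule_ge0 ?poweR_ge0// lee_fin invr_ge0 divr_ge0 ?(ltW t00)//.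
    by rewrite exprn_ge0 ?ltW.
  - by rewrite mule_ge0 ?poweR_ge0// lee_fin invr_ge0 ltW.
  - move=> t /=; rewrite !in_itv/= => /andP[tp t1].
    have [t0t|tt0] := leP t0 t; first by left.
    have [|j tj] := @source_block_cover _ C t0 C1 t; first by rewrite tp.
    by right; exists j.
  - move=> t /=; rewrite in_itv/= => /andP[tp t1].
    by rewrite mule_ge0 ?poweR_ge0// lee_fin invr_ge0 ltW.
  - move=> t /= _; rewrite in_itv/= => t0t; have /andP[t01 t1] := t0t.
    have tp : (0 < t)%R := lt_le_trans t00 t01.
    apply: lee_pmul; rewrite ?poweR_ge0 ?lee_fin ?invr_ge0 ?(ltW tp)//.
      by apply: poweR_mono; rewrite ?(ltW p0)// FS.
    by rewrite lef_pV2 ?posrE.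
  - move=> j t _ tj; have tp := source_block_gt0 C1 t00 tj.
    apply: lee_pmul; rewrite ?poweR_ge0 ?lee_fin ?invr_ge0 ?(ltW tp)//.
      by apply: poweR_mono; rewrite ?(ltW p0)// Fb.
    rewrite lef_pV2 ?posrE// ?divr_gt0 ?exprn_gt0//.
    by move: tj; rewrite /source_block /= in_itv/= => /andP[].
apply: (le_trans hI).
have -> : \sum_(j <oo) ((K0%:E * b j) `^ p * ((t0 / C ^+ j.+1)^-1)%:E) *
    leb (source_block C t0 j) =
    (2 * (C - 1) * K0 `^ p)%:E * \sum_(j <oo) (b j `^ p * 2^-1%:E).
  rewrite -nneseriesZl; last by move=> j _; rewrite mule_ge0 ?poweR_ge0// lee_fin.
  apply: eq_eseriesr => j _.
  rewrite [leb _](measure_source_block C1 t00) poweRM ?lee_fin ?(ltW K00)// poweR_EFin.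
  rewrite -muleA -EFinM mulrA mulVf ?mul1r; last first.
    by rewrite gt_eqF// divr_gt0 ?exprn_gt0.
  rewrite muleAC -EFinM [b j `^ p * _]muleC [in RHS]muleA -EFinM; congr (_%:E * _).
  by field.
rewrite [leLHS]addeC /A EFinD ge0_muleDl; last 2 first.
- by rewrite lee_fin !mulr_ge0 ?powR_ge0 ?subr_ge0 ?(ltW C1).
- by rewrite lee_fin mulr_ge0 ?powR_ge0 ?invr_ge0 ?(ltW t00).
apply: leeD; last first.
  rewrite lebesgue_measure_itv/= -muleA.
  apply: (@le_trans _ _ ((K1%:E * S) `^ p * (t0^-1)%:E)).
    rewrite lee_wpmul2l ?poweR_ge0// -[leRHS]mule1 lee_wpmul2l ?lee_fin ?invr_ge0 ?(ltW t00)//.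
    by case: ifPn => _ //; rewrite -EFinB lee_fin gerBl ltW.
  rewrite poweRM ?lee_fin ?(ltW K10)// poweR_EFin muleAC -EFinM.
  rewrite lee_wpmul2l ?lee_fin ?mulr_ge0 ?powR_ge0 ?invr_ge0 ?(ltW t00)//.
  by apply: poweR_mono; rewrite ?(ltW p0)// leeDr// poweR_ge0.
rewrite lee_wpmul2l ?lee_fin ?mulr_ge0 ?powR_ge0 ?subr_ge0 ?(ltW C1)//.
apply: (le_trans hJ).
apply: (@le_trans _ _ ((J `^ p^-1) `^ p)).
  by rewrite -poweRrM mulVf ?gt_eqF// poweRe1.
by apply: poweR_mono; [exact: ltW|exact: poweR_ge0|rewrite leeDl].
Qed.

(** A single radius in the block matching t suffices for a supremum. *)
Lemma Lq_compare_sup : exists2 K : R, (0 < K)%R &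
  forall F G S, block_dominated F G S ->
    Lq_dt_t +oo `]0%R, 1%R[ F <= K%:E * (Lq_dt_t +oo `]0%R, +oo[ G + S).
Proof.
exists (K0 + K1)%R; first by rewrite addr_gt0.
move=> F G S [F0 G0 S0 FG FS] /=.
have sG r : (0 < r)%R -> G r <= ereal_sup [set G t | t in `]0%R, +oo[].
  by move=> r0; apply: ereal_sup_ubound; exists r => //=; rewrite in_itv/= r0.
set L := ereal_sup [set G t | t in _] in sG *.
have L0 : 0 <= L by apply: (le_trans (G0 1%R)); exact: sG.
apply: ge_ereal_sup => _ [t /= + <-]; rewrite in_itv/= => /andP[tp t1].
have [t0t|tt0] := leP t0 t.
  apply: (le_trans (FS t _)); first by rewrite t0t.
  apply: lee_pmul => //; rewrite ?lee_fin ?(ltW K10)//.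
    by rewrite lerDr ltW.
  by rewrite leeDr.
have [|j tj] := @source_block_cover _ C t0 C1 t; first by rewrite tp.
pose r : R := ((2 ^+ j)^-1)%R.
have r0 : (0 < r)%R by rewrite invr_gt0 exprn_gt0.
apply: (le_trans (FG j t r tj _)).
  by rewrite /target_block /= in_itv/= lexx/= ltr_pMl// ltr1n.
apply: lee_pmul => //; rewrite ?lee_fin ?(ltW K00)//.
  by rewrite lerDl ltW.
by apply: (le_trans (sG r r0)); rewrite leeDl.
Qed.

Lemma Lq_compare (q : \bar R) : 0 < q -> exists2 K : R, (0 < K)%R &
  forall F G S, block_dominated F G S ->
    Lq_dt_t q `]0%R, 1%R[ F <= K%:E * (Lq_dt_t q `]0%R, +oo[ G + S).
Proof.
case: q => [p||//]; last by move=> _; exact: Lq_compare_sup.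
by rewrite lte_fin; exact: Lq_compare_fin.
Qed.

End Lq_comparison.

(** * Doubling constant and upper dimension *)
Section upper_dimension.
Context {R : realType} {d : measure_display} {T : metricMeasurableType R d}.
Variable mu : {measure set T -> \bar R}.
Hypothesis T_borel : borel_space T.
Hypothesis mu_doubling : doubling_measure mu.
Hypothesis mu_infinite : mu setT = +oo%E.
Local Notation Cmu := (doubling_constant mu).
Local Notation Q := (upper_dim mu).

Lemma infinite_point : exists x : T, True.
Proof.
apply/not_existsP => T0; have : mu setT = 0%E.
  by rewrite (_ : setT = set0) ?measure0// -subset0 => x _; exact: T0 x I.
by rewrite mu_infinite.
Qed.

Lemma doubling_constant_inf : has_inf (doubling_constants mu).
Proof.
split; first by case: mu_doubling.
by exists 1 => C [/ltW].
Qed.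

Lemma doubling_with_constant : doubling_with mu Cmu.
Proof.
move=> x r r0.
have fB : mu (ball x r) \is a fin_num by exact: mu_ball_fin.
have fB2 : mu (ball x (2 * r)) \is a fin_num by rewrite mu_ball_fin// mulr_gt0.
have B0 : 0 < fine (mu (ball x r)) by rewrite fine_gt0// mu_ball_gt0//= mu_ball_lty.
rewrite -(fineK fB) -(fineK fB2) -EFinM lee_fin -ler_pdivrMr//.
apply: lb_le_inf; first by case: doubling_constant_inf.
move=> C [C1 dC]; rewrite ler_pdivrMr// -lee_fin EFinM !fineK//.
exact: dC.
Qed.

Lemma doubling_constant_ge1 : 1 <= Cmu.
Proof.
apply: lb_le_inf; first by case: doubling_constant_inf.
by move=> C [/ltW].
Qed.

Lemma doubling_iter_constant n (x : T) (r : R) : 0 < r ->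
  (mu (ball x (2 ^+ n * r)) <= (Cmu ^+ n)%:E * mu (ball x r))%E.
Proof.
apply: doubling_iter; last exact: doubling_with_constant.
exact: le_trans doubling_constant_ge1.
Qed.

(** A doubling constant equal to 1 would bound the measures of all balls around
    a point by that of one of them, against the infinite total mass. *)
Lemma doubling_constant_gt1 : 1 < Cmu.
Proof.
rewrite lt_neqAle doubling_constant_ge1 andbT eq_sym; apply/eqP => C1.
have [x _] := infinite_point.
have cv : mu (ball x (2 ^+ n * 1)) @[n --> \oo] --> mu (\bigcup_n ball x (2 ^+ n * 1)).
  apply: nondecreasing_cvg_mu.
  - by move=> n; exact: measurable_mball.
  - by apply: bigcup_measurable => n _; exact: measurable_mball.
  - apply/nondecreasing_seqP => n; apply/subsetPset; apply: sub_ball.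
    by rewrite mdistxx add0r !mulr1 exprS ler_peMl ?exprn_ge0// ler1n.
have UT : \bigcup_n ball x (2 ^+ n * 1) = setT.
  apply/seteqP; split => // y _; exists (Num.truncn (mdist x y)).+1 => //.
  rewrite ballEmdist/= mulr1 (lt_le_trans (truncnS_gt _))//.
  by rewrite -natrX ler_nat ltnW// ltn_expl.
have : (mu setT <= mu (ball x 1))%E.
  rewrite -UT -(cvg_lim _ cv)//; apply: lime_le.
    by apply/cvg_ex; eexists; exact: cv.
  apply: nearW => n; apply: (le_trans (doubling_iter_constant n x ltr01)).
  by rewrite C1 expr1n mul1e.
by rewrite mu_infinite leye_eq => /eqP h; have := mu_ball_lty mu_doubling x ltr01; rewrite h.
Qed.

Lemma upper_dim_gt0 : 0 < Q.
Proof.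
by rewrite divr_gt0// ln_gt0 ?doubling_constant_gt1// ltr1n.
Qed.

(** Equivalently C = 2^Q: a time scaled by C corresponds to a radius scaled by 2,
    which keeps t^(s/Q) and r^s comparable. *)
Lemma doubling_constant_powR : Cmu `^ Q^-1 = 2.
Proof.
have C0 : 0 < Cmu := lt_trans ltr01 doubling_constant_gt1.
have l0 : ln Cmu != 0 by rewrite gt_eqF// ln_gt0// doubling_constant_gt1.
rewrite /powR gt_eqF//= /upper_dim invf_div mulfVK// lnK// posrE//.
Qed.

End upper_dimension.

(** * Noncollapsing implies the estimate *)
Section noncollapsing_to_estimate.
Context {R : realType} {d : measure_display} {T : metricMeasurableType R d}.
Variable mu : {measure set T -> \bar R}.
Hypothesis T_borel : borel_space T.
Hypothesis mu_doubling : doubling_measure mu.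
Hypothesis mu_infinite : mu setT = +oo%E.
Hypothesis mu_atomless : forall x : T, mu [set x] = 0%E.
Local Notation Cmu := (doubling_constant mu).
Local Notation Q := (upper_dim mu).

(** Doubling j times leads from radius 2^-j to radius 1. *)
Lemma noncollapsing_dyadic : noncollapsing mu -> exists2 b : R, 0 < b <= 1 &
  forall j x, ((b / Cmu ^+ j)%:E <= mu (ball x (2 ^+ j)^-1))%E.
Proof.
move=> [b b0 hb]; exists (Num.min b 1); first by rewrite lt_min b0 ltr01 ge_min lexx orbT.
move=> j x.
have C0 : 0 < Cmu := lt_trans ltr01 (doubling_constant_gt1 T_borel mu_doubling mu_infinite).
have r0 : 0 < (2 ^+ j)^-1 :> R by rewrite invr_gt0 exprn_gt0.
have b1 : (b%:E <= mu (ball x 1))%E.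
  by rewrite -hb; apply: ereal_inf_lbound; exists x.
have := doubling_iter_constant mu_doubling j x r0.
rewrite mulfV ?expf_neq0// => h.
rewrite mulrC EFinM lee_pdivrMl ?exprn_gt0//; apply: (le_trans _ h).
by apply: (le_trans _ b1); rewrite lee_fin ge_min lexx.
Qed.

(** For t in the j-th source block and r in the j-th target block, the ball of
    radius r has measure at least b / C^j >= 2t, so [oscill_modulus] applies.  The
    constants are uniform in s because 4^s <= 4 and t0^(1/Q) <= t0^(s/Q). *)
Lemma noncollapsing_estimate (alpha : R) (q : \bar R) : noncollapsing mu ->
  0 < alpha <= 1 -> (0 < q)%E ->
  exists2 C : R, 0 < C &
    forall s : R, 0 < s < 1 ->
    forall X : qri_space mu, is_ri X -> normalized X ->
    forall f : T -> R, sum_space mu alpha f ->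
      (oscill_norm X alpha s q f
       <= C%:E * (besov_seminorm X alpha s q f + sum_norm mu alpha f))%E.
Proof.
move=> /noncollapsing_dyadic[b /andP[b0 b1] hb] a01 q0.
have /andP[a0 a1] := a01.
have mu_div : divisible mu by exact: doubling_divisible.
have C1 := doubling_constant_gt1 T_borel mu_doubling mu_infinite.
have C0 : 0 < Cmu := lt_trans ltr01 C1.
have Q0 := upper_dim_gt0 T_borel mu_doubling mu_infinite.
(* the halving makes 2t <= b / C^j for t below t0 / C^j *)
pose t0 := b / 2.
have t00 : 0 < t0 by rewrite divr_gt0.
have t01 : t0 <= 1 by rewrite ler_pdivrMr// mul1r (le_trans b1)// ler1n.
pose K0 := 2 `^ alpha^-1 * (4 * (t0 `^ Q^-1)^-1).
pose K1 := (2 / t0) `^ alpha^-1 * (t0 `^ Q^-1)^-1.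
have K00 : 0 < K0 by rewrite !mulr_gt0 ?invr_gt0 ?powR_gt0.
have K10 : 0 < K1 by rewrite !mulr_gt0 ?invr_gt0 ?powR_gt0// divr_gt0.
have t001 : 0 < t0 <= 1 by rewrite t00.
have [K Kp hK] := Lq_compare C1 t001 K00 K10 q0.
exists K => // s /andP[s0 s1] X riX nX f fs; apply: hK.
have tsQ t : 0 < t -> t `^ (s / Q) = (t `^ Q^-1) `^ s by move=> _; rewrite mulrC powRrM.
have t0s : (t0 `^ Q^-1) <= t0 `^ (s / Q).
  rewrite tsQ//; apply: ger1_powR; last exact: ltW.
  rewrite powR_gt0//= [leRHS](_ : 1 = 1 `^ Q^-1); last by rewrite powR1.
  by apply: ge0_ler_powR; rewrite ?nnegrE ?invr_ge0 ?(ltW Q0) ?(ltW t00).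
split.
- move=> t; apply: mule_ge0; last by rewrite lee_fin invr_ge0 powR_ge0.
  apply: mule_ge0; first exact: poweR_ge0.
  by apply: fundamental_ge0 => E; exact: poweR_ge0.
- by move=> r; rewrite mule_ge0 ?poweR_ge0// lee_fin powR_ge0.
- by apply: le_ereal_inf_tmp => _ [h _ <-]; rewrite adde_ge0// Lnorm_ge0.
- move=> j t r tj rj.
  have tp := source_block_gt0 C1 t00 tj.
  move: tj rj; rewrite /source_block /target_block /= !in_itv/= => /andP[tj1 tj2] /andP[rj1 rj2].
  have r0 : 0 < r by rewrite (lt_le_trans _ rj1)// invr_gt0 exprn_gt0.
  have tB x : ((2 * t)%:E <= mu (ball x r))%E.
    apply: (@le_trans _ _ (b / Cmu ^+ j)%:E).
      rewrite lee_fin mulrC -ler_pdivlMr// mulrAC; exact: ltW.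
    apply: (le_trans (hb j x)); exact: le_measure_ballr.
  have ho := oscill_modulus T_borel mu_doubling mu_div mu_infinite a01 fs riX r0 tp tB.
  have ratio : (t `^ (s / Q))^-1 <= 4 * (t0 `^ Q^-1)^-1 * r `^ (- s).
    (* r < 4 / 2^(j+1), and 2^-(j+1) is the 1/Q-th power of C^-(j+1) <= t / t0 *)
    have tQ : t0 `^ Q^-1 * r <= 4 * t `^ Q^-1.
      apply: (@le_trans _ _ (t0 `^ Q^-1 * (4 * (2 ^+ j.+1)^-1))).
        rewrite ler_pM2l ?powR_gt0//; apply: (le_trans (ltW rj2)).
        by rewrite exprS invfM; lra.
      rewrite mulrCA ler_pM2l//.
      have -> : (2 ^+ j.+1)^-1 = (Cmu ^+ j.+1)^-1 `^ Q^-1 :> R.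
        rewrite -[2 in LHS](doubling_constant_powR T_borel mu_doubling mu_infinite).
        rewrite -[in LHS]powR_mulrn ?powR_ge0// -[in LHS]powRN -[in LHS]powRrM.
        rewrite -[in RHS]powR_mulrn ?(ltW C0)// -[in RHS]powRN -[in RHS]powRrM.
        by congr (_ `^ _); lra.
      rewrite -powRM ?invr_ge0 ?exprn_ge0 ?(ltW C0) ?(ltW t00)//.
      apply: ge0_ler_powR; rewrite ?nnegrE ?invr_ge0 ?(ltW Q0) ?(ltW tp)//.
      by rewrite divr_ge0 ?exprn_ge0 ?(ltW C0) ?(ltW t00).
    have tQs : (t0 `^ Q^-1) `^ s * r `^ s <= 4 `^ s * t `^ (s / Q).
      rewrite tsQ// -!powRM ?powR_ge0 ?(ltW r0)//.
      apply: ge0_ler_powR => //; rewrite ?nnegrE ?mulr_ge0 ?powR_ge0 ?(ltW r0) ?(ltW s0)//.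
    rewrite powRN -mulrA -invfM.
    have B0 : 0 < t0 `^ Q^-1 by rewrite powR_gt0.
    have rs0 : 0 < r `^ s by rewrite powR_gt0.
    rewrite ler_pdivlMr ?mulr_gt0// ler_pdivrMl ?powR_gt0// mulrC.
    apply: (@le_trans _ _ ((t0 `^ Q^-1) `^ s * r `^ s)).
      by rewrite mulrC ler_pM2r// -tsQ.
    apply: (le_trans tQs); rewrite mulrC ler_pM2l ?powR_gt0//.
    by rewrite -[leRHS]powRr1//; apply: ler_powR; rewrite ?ler1n// ltW.
  apply: (@le_trans _ _ ((2 `^ alpha^-1)%:E * modulus X alpha f r *
      (4 * (t0 `^ Q^-1)^-1 * r `^ (- s))%:E)%E).
    apply: lee_pmul => //.
    - apply: mule_ge0; first exact: poweR_ge0.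
      by apply: fundamental_ge0 => E; exact: poweR_ge0.
    - by rewrite lee_fin invr_ge0 powR_ge0.
  by rewrite muleAC -EFinM [in leRHS]muleA -EFinM /K0 !mulrA.
- move=> t /andP[t0t t1]; have tp : 0 < t := lt_le_trans t00 t0t.
  have S0 : (0 <= sum_norm mu alpha f)%E.
    by apply: le_ereal_inf_tmp => _ [h _ <-]; rewrite adde_ge0// Lnorm_ge0.
  have ho : (oscill mu (pow_abs alpha f) t `^ alpha^-1 *
      fundamental mu (convex_norm X alpha) t
      <= ((2 / t) `^ alpha^-1)%:E * sum_norm mu alpha f)%E.
    by apply: oscill_crude => //; rewrite tp ltW.
  apply: (@le_trans _ _ (((2 / t) `^ alpha^-1)%:E * sum_norm mu alpha f *
      ((t0 `^ Q^-1)^-1)%:E)%E).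
    apply: lee_pmul => //.
    - apply: mule_ge0; first exact: poweR_ge0.
      by apply: fundamental_ge0 => E; exact: poweR_ge0.
    - by rewrite lee_fin invr_ge0 powR_ge0.
    - rewrite lee_fin lef_pV2 ?posrE ?powR_gt0//; apply: (le_trans t0s).
      apply: ge0_ler_powR; rewrite ?nnegrE ?(ltW t00) ?(ltW tp)//.
      by rewrite divr_ge0 ?ltW.
  rewrite muleAC -EFinM /K1 lee_wpmul2r// lee_fin ler_pM2r ?invr_gt0 ?powR_gt0//.
  apply: ge0_ler_powR; rewrite ?nnegrE ?invr_ge0 ?divr_ge0 ?(ltW t00) ?(ltW tp) ?(ltW a0) ?(ltW b0)//.
  by rewrite ler_pM2l// lef_pV2 ?posrE.
Qed.

End noncollapsing_to_estimate.

(** * The space L^oo *)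
Section Linfty.
Context {R : realType} {d : measure_display} {T : measurableType d}.
Variable mu : {measure set T -> \bar R}.
Implicit Types f g : T -> R.

(** The value at 0 of the rearrangement is the essential supremum of |f|.  With this
    definition invariance under rearrangement is immediate. *)
Definition linf_car : set (T -> R) :=
  [set f | measurable_fun setT f /\ (rearr mu f 0 < +oo)%E].
Definition linf_norm f : R := fine (rearr mu f 0).

Lemma rearr0_leP f (M : R) : measurable_fun setT f -> 0 <= M ->
  (rearr mu f 0 <= M%:E)%E <-> {ae mu, forall x, `|f x| <= M}.
Proof.
move=> mf M0; split => [/(distrib_rearr mf) h|[N [mN N0 hN]]].
  exists [set x | M < `|f x|]; split.
  - exact: measurable_level.
  - by apply/eqP; rewrite eq_le h /=.
  - by move=> x /= /negP; rewrite -ltNge.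
apply: rearr_le => //; apply: (@le_trans _ _ (mu N)); last by rewrite N0.
  apply: le_measure; rewrite ?inE//.
  exact: measurable_level.
by move=> x /= Mx; apply: hN => /=; apply/negP; rewrite -ltNge.
Qed.

Lemma linf_norm_ge0 f : 0 <= linf_norm f.
Proof. by rewrite fine_ge0// rearr_ge0. Qed.

Lemma linf_normE f : linf_car f -> rearr mu f 0 = (linf_norm f)%:E.
Proof. by move=> [_ h]; rewrite fineK// ge0_fin_numE// rearr_ge0. Qed.

Lemma linf_ae f : linf_car f -> {ae mu, forall x, `|f x| <= linf_norm f}.
Proof.
move=> Xf; apply/rearr0_leP; [by case: Xf|exact: linf_norm_ge0|].
by rewrite linf_normE.
Qed.

Lemma linf_le f (M : R) : measurable_fun setT f -> 0 <= M ->
  {ae mu, forall x, `|f x| <= M} -> linf_car f /\ linf_norm f <= M.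
Proof.
move=> mf M0 /(rearr0_leP mf M0) h.
have Xf : linf_car f by split => //; exact: le_lt_trans h (ltry _).
by split => //; rewrite -lee_fin -linf_normE.
Qed.

Lemma linf_add f g : linf_car f -> linf_car g ->
  linf_car (f \+ g) /\ linf_norm (f \+ g) <= linf_norm f + linf_norm g.
Proof.
move=> Xf Xg; have [mf _] := Xf; have [mg _] := Xg.
apply: linf_le; [exact: measurable_funD|by rewrite addr_ge0 ?linf_norm_ge0|].
apply: filterS2 (linf_ae Xf) (linf_ae Xg) => x fx gx.
by rewrite (le_trans (ler_normD _ _))// lerD.
Qed.

Lemma linf_scale (c : R) f : linf_car f ->
  linf_car (fun x => c * f x) /\ linf_norm (fun x => c * f x) <= `|c| * linf_norm f.
Proof.
move=> Xf; have [mf _] := Xf; apply: linf_le.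
- by apply: measurable_funM.
- by rewrite mulr_ge0// linf_norm_ge0.
- by apply: filterS (linf_ae Xf) => x fx; rewrite normrM ler_wpM2l.
Qed.

Lemma linf_null f : linf_car f ->
  (linf_norm f = 0 <-> {ae mu, forall x, f x = 0}).
Proof.
move=> Xf; have [mf _] := Xf; split => [f0|f0].
  apply: filterS (linf_ae Xf) => x; rewrite f0 normr_le0 => /eqP//.
have [|_] := @linf_le f 0 mf (lexx _).
  by apply: filterS f0 => x ->; rewrite normr0.
by move=> h; apply/eqP; rewrite eq_le h linf_norm_ge0.
Qed.

Lemma linf_homo (c : R) f : linf_car f ->
  linf_norm (fun x => c * f x) = `|c| * linf_norm f.
Proof.
move=> Xf; have [Xcf le1] := linf_scale c Xf.
apply/eqP; rewrite eq_le le1 /=.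
have [->|c0] := eqVneq c 0; first by rewrite normr0 mul0r linf_norm_ge0.
have [_] := linf_scale c^-1 Xcf.
have -> : (fun x => c^-1 * (c * f x)) = f.
  by apply/funext => x; rewrite mulrA mulVf// mul1r.
by rewrite normfV ler_pdivlMl ?normr_gt0.
Qed.

(** Off one null set the sequence is uniformly Cauchy.  Multiplying it by the
    indicator of the complement makes it converge everywhere, so that the limit
    is measurable. *)
Lemma linf_complete (u : nat -> T -> R) : (forall n, linf_car (u n)) ->
  (forall e : R, 0 < e -> exists N : nat, forall m n : nat,
     (N <= m)%N -> (N <= n)%N -> linf_norm (u m \- u n) < e) ->
  exists2 f, linf_car f & linf_norm (u n \- f) @[n --> \oo] --> (0 : R).
Proof.
move=> Xu cu.
have mu_ n : measurable_fun setT (u n) by have [] := Xu n.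
have XB m n : linf_car (u m \- u n).
  have [XN _] := linf_scale (-1) (Xu n).
  have [+ _] := linf_add (Xu m) XN; congr linf_car.
  by apply/funext => x /=; rewrite mulN1r.
have : {ae mu, forall x, forall m n, `|u m x - u n x| <= linf_norm (u m \- u n)}.
  by apply: ae_foralln => m; apply: ae_foralln => n; exact: linf_ae (XB m n).
move=> [N [mN N0 hN]].
have hu x : ~ N x -> forall m n, `|u m x - u n x| <= linf_norm (u m \- u n).
  by move=> Nx; apply: contrapT => h; apply: Nx; exact: hN.
pose w n x := u n x * \1_(~` N) x.
have cw x : cvgn (w ^~ x).
  apply/cauchy_cvgP; apply: cauchy_exP => e e0.
  have [K hK] := cu e e0; exists (w K x); exists K => // n /= Kn.
  rewrite /ball/= /w -mulrBl normrM indicE.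
  case: (boolP (x \in ~` N)) => [/set_mem Nx|_]; last by rewrite normr0 mulr0.
  by rewrite normr1 mulr1 (le_lt_trans (hu x Nx _ _))// hK.
pose f x := limn (w ^~ x).
have wf x : w n x @[n --> \oo] --> f x by exact: cw.
have mf : measurable_fun setT f.
  apply: (@measurable_fun_cvg _ _ _ setT w) => // n.
  by apply: measurable_funM => //; apply: measurable_indic; exact: measurableC.
have uf e : 0 < e -> exists K : nat, forall n, (K <= n)%N ->
    {ae mu, forall x, `|u n x - f x| <= e}.
  move=> e0; have [K hK] := cu e e0; exists K => n Kn.
  exists N; split => // x /= h; apply: contrapT => Nx; apply: h.
  have wu k : w k x = u k x by rewrite /w indicE mem_set// mulr1.
  have cd : `|u n x - w k x| @[k --> \oo] --> `|u n x - f x|.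
    by apply: cvg_norm; apply: cvgB => //; exact: cvg_cst.
  rewrite -(cvg_lim _ cd)//; apply: limr_le; first by apply/cvg_ex; eexists; exact: cd.
  exists K => // k /= Kk; rewrite wu.
  by rewrite (le_trans (hu x Nx _ _))// ltW// hK.
have Xf : linf_car f.
  have [K hK] := uf 1 ltr01.
  have K0 : 0 <= linf_norm (u K) + 1 by rewrite addr_ge0// linf_norm_ge0.
  apply: (linf_le mf K0 _).1.
  apply: filterS2 (linf_ae (Xu K)) (hK K (leqnn _)) => x ux ufx.
  rewrite -[f x](subrK (u K x)) addrC (le_trans (ler_normD _ _))//.
  by rewrite lerD// distrC.
exists f => //; apply/cvgrPdist_le => e e0; have [K hK] := uf e e0.
exists K => // n /= Kn; rewrite sub0r normrN ger0_norm ?linf_norm_ge0//.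
have muf : measurable_fun setT (u n \- f) by exact: measurable_funB.
by have [] := linf_le muf (ltW e0) (hK n Kn).
Qed.

Lemma linf_embed f : linf_car f ->
  forall (E : set T) (e del : R), measurable E -> (mu E < +oo)%E ->
  0 < e -> 0 < del -> exists2 eta : R, 0 < eta &
    forall g, linf_car g -> linf_norm (g \- f) < eta ->
      (mu (E `&` [set x | (e < `|g x - f x|)%R]) < del%:E)%E.
Proof.
move=> Xf E e del mE _ e0 del0; exists e => // g Xg hg.
have mgf : measurable_fun setT (g \- f).
  by have [mf _] := Xf; have [mg _] := Xg; exact: measurable_funB.
have Xgf : linf_car (g \- f).
  have [XN _] := linf_scale (-1) Xf.
  have [+ _] := linf_add Xg XN; congr linf_car.
  by apply/funext => x /=; rewrite mulN1r.
apply: (@le_lt_trans _ _ (distrib_fun mu (g \- f) e)).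
  apply: le_measure; rewrite ?inE; last by move=> x [].
    by apply: measurableI => //; exact: (measurable_level e mgf).
  exact: measurable_level.
apply: (@le_lt_trans _ _ 0%E); last by rewrite lte_fin.
by apply: distrib_rearr => //; rewrite linf_normE// lee_fin ltW.
Qed.

Lemma linf_indic (E : set T) : measurable E -> linf_car \1_E /\ linf_norm \1_E <= 1.
Proof.
move=> mE; apply: linf_le => //.
by apply: aeW => x; rewrite indicE; case: (_ \in _); rewrite ?normr1// normr0.
Qed.

Lemma linf_fatou (u : nat -> T -> R) f :
  (forall n, measurable_fun setT (u n)) -> linf_car f ->
  {ae mu, forall x, (forall n, 0 <= u n x <= u n.+1 x) /\
                    u n x @[n --> \oo] --> f x} ->
  [/\ forall n, linf_car (u n),
      forall n, linf_norm (u n) <= linf_norm (u n.+1) &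
      linf_norm (u n) @[n --> \oo] --> linf_norm f].
Proof.
move=> mu_ Xf uf.
have uf' : {ae mu, forall x, (forall n, `|u n x| <= u n.+1 x /\ `|u n x| <= f x)}.
  apply: filterS uf => x [h1 h2] n; have /andP[u0 uS] := h1 n.
  rewrite ger0_norm//; split => //.
  rewrite -(cvg_lim _ h2)//; apply: (@nondecreasing_cvgn_le _ (u ^~ x)).
    by apply/nondecreasing_seqP => k; have /andP[] := h1 k.
  by apply/cvg_ex; eexists; exact: h2.
have Xu n : linf_car (u n) /\ linf_norm (u n) <= linf_norm f.
  apply: linf_le => //; first exact: linf_norm_ge0.
  apply: filterS2 uf' (linf_ae Xf) => x /(_ n)[_ h] fx.
  by rewrite (le_trans h)// (le_trans (ler_norm _)).
have nu n : linf_norm (u n) <= linf_norm (u n.+1).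
  apply: (linf_le (mu_ n) (linf_norm_ge0 (u n.+1)) _).2.
  apply: filterS2 uf' (linf_ae (Xu n.+1).1) => x /(_ n)[h _] fx.
  by rewrite (le_trans h)// (le_trans (ler_norm _)).
split => //; first by move=> n; exact: (Xu n).1.
have nd : nondecreasing_seq (fun n => linf_norm (u n)) by exact/nondecreasing_seqP.
have cn : cvgn (fun n => linf_norm (u n)).
  apply: nondecreasing_is_cvgn => //; exists (linf_norm f) => _ [n _ <-].
  exact: (Xu n).2.
suff <- : limn (fun n => linf_norm (u n)) = linf_norm f by [].
apply/eqP; rewrite eq_le; apply/andP; split.
  by apply: limr_le => //; apply: nearW => n; exact: (Xu n).2.
have unl n : linf_norm (u n) <= limn (fun n => linf_norm (u n)).
  exact: nondecreasing_cvgn_le.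
have mf : measurable_fun setT f by case: Xf.
apply: (linf_le mf (le_trans (linf_norm_ge0 (u 0%N)) (unl 0%N)) _).2.
have := ae_foralln (fun n => linf_ae (Xu n).1).
apply: filterS2 uf => x [h1 h2] h3.
have cf : `|u n x| @[n --> \oo] --> `|f x| by exact: cvg_norm.
rewrite -(cvg_lim _ cf)//; apply: limr_le; first by apply/cvg_ex; eexists; exact: cf.
by apply: nearW => n; exact: le_trans (h3 n) (unl n).
Qed.

Definition linfty : qri_space mu.
Proof.
refine (@QriSpace _ _ _ mu linf_car linf_norm _ _ _ _ _ _ _ _ _ _ _ _).
- by move=> f [].
- by move=> f g Xf Xg; have [] := linf_add Xf Xg.
- by move=> c f Xf; have [] := linf_scale c Xf.
- by move=> f _; exact: linf_norm_ge0.
- exact: linf_null.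
- exact: linf_homo.
- by exists 1 => // f g Xf Xg; rewrite mul1r; have [] := linf_add Xf Xg.
- exact: linf_complete.
- exact: linf_embed.
- by move=> E mE _; have [] := linf_indic mE.
- exact: linf_fatou.
- move=> f g [mf f0] mg fg; have E := fg 0 (lexx _).
  by split; [split => //; rewrite -E|rewrite /linf_norm E].
Defined.

Lemma linfty_ri : is_ri linfty.
Proof. by move=> f g Xf Xg; have [] := linf_add Xf Xg. Qed.

Lemma linf_norm_indic (E : set T) : measurable E -> (0 < mu E)%E ->
  linf_norm \1_E = 1.
Proof.
move=> mE E0; have [XE E1] := linf_indic mE.
apply/eqP; rewrite eq_le E1/= leNgt; apply/negP => lt1.
have [N [mN N0 hN]] := linf_ae XE.
have : (mu E <= 0)%E.
  rewrite -N0; apply: le_measure; rewrite ?inE// => x Ex; apply: hN => /=.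
  by rewrite indicE mem_set// normr1; apply/negP; rewrite -ltNge.
by rewrite leNgt E0.
Qed.

Hypothesis mu_div : divisible mu.
Hypothesis mu_inf : mu setT = +oo%E.

Lemma linfty_fundamental (a t : R) : 0 < a -> 0 < t ->
  fundamental mu (convex_norm linfty a) t = 1%E.
Proof.
move=> a0 t0.
have [E [mE muE ->]] := fundamentalE mu_div mu_inf (convex_norm linfty a) (ltW t0).
rewrite convex_norm_indic//; last by rewrite muE ltry.
by rewrite /= linf_norm_indic ?powR1// muE lte_fin.
Qed.

Lemma linfty_normalized : normalized linfty.
Proof.
rewrite /normalized.
have [E [mE muE ->]] := fundamentalE mu_div mu_inf (xnorm linfty) ler01.
rewrite /xnorm; case: pselect => [XE|nXE] /=.
  by rewrite linf_norm_indic// muE lte_fin.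
by have := (linf_indic mE).1 => /nXE.
Qed.

End Linfty.

(** * Integrals over moving balls *)
Section lower_semicontinuity.
Context {R : realType} {d : measure_display} {T : metricMeasurableType R d}.
Variable mu : {measure set T -> \bar R}.
Hypothesis T_borel : borel_space T.

Lemma measurable_lsc (u : T -> \bar R) :
  (forall c : R, open [set x | (c%:E < u x)%E]) -> measurable_fun setT u.
Proof.
move=> ou; apply: (measurability _ (ErealGenOInfty.measurableE R)) => //.
move=> _ [_ [c ->] <-]; rewrite setTI; apply: (measurable_open T_borel).
have -> // : u @^-1` `]c%:E, +oo[ = [set x | (c%:E < u x)%E].
by apply/seteqP; split => x /=; rewrite in_itv/= andbT.
Qed.

Variable w : T -> T -> R.
Hypothesis w0 : forall x y, 0 <= w x y.
Hypothesis mw : forall x, measurable_fun setT (w x).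
Hypothesis w_lip : forall x x' y, w x y <= w x' y + mdist x x'.
Variable r : R.

Let psi x := (\int[mu]_(y in ball x r) (w x y)%:E)%E.

(** The integral is lower semicontinuous in the centre: moving the centre by delta
    leaves at least the ball of radius r - delta and lowers the integrand by at
    most delta, and both losses vanish monotonically as delta tends to 0. *)
Lemma measurable_ball_integral : measurable_fun setT psi.
Proof.
apply: measurable_lsc => c; rewrite openE => x /= cx.
pose del n : R := n.+1%:R^-1.
have del0 n : 0 < del n by rewrite /del.
have deln m n : (m <= n)%N -> del n <= del m.
  by move=> mn; rewrite /del lef_pV2 ?posrE// ler_nat.
pose h n y := Num.max 0 (w x y - del n) * \1_(ball x (r - del n)) y.
have h0 n y : 0 <= h n y by rewrite mulr_ge0// ?le_max ?lexx// indicE ler0n.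
have mh n : measurable_fun setT (h n).
  apply: measurable_funM; last exact/measurable_indic/measurable_mball.
  by apply: measurable_maxr => //; exact: measurable_funB.
have hnd y m n : (m <= n)%N -> h m y <= h n y.
  move=> mn; rewrite /h !indicE.
  case: (boolP (y \in (ball x (r - del m) : set T))) => [/set_mem ym|_]; last by rewrite mulr0 h0.
  have yn : ball x (r - del n) y.
    by apply: sub_ball ym; rewrite mdistxx add0r lerB// deln.
  rewrite (mem_set yn) !mulr1 ge_max !le_max lexx/=.
  by rewrite lerB ?orbT// deln.
have hcv y : h n y @[n --> \oo] --> w x y * \1_(ball x r) y.
  have [yr|yr] := pselect (ball x r y); last first.
    rewrite indicE memNset// mulr0.
    rewrite (_ : h ^~ y = cst 0); first exact: cvg_cst.
    apply/funext => n; rewrite /h indicE memNset ?mulr0// => yn; apply: yr.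
    by apply: sub_ball yn; rewrite mdistxx add0r gerBl ltW.
  rewrite indicE mem_set// mulr1; apply/cvgrPdist_le => e e0.
  have xyr : 0 < Num.min e (r - mdist x y).
    by rewrite lt_min e0 subr_gt0; move: yr; rewrite ballEmdist.
  have [N hN] : exists N : nat, 0 + N.+1%:R^-1 < Num.min e (r - mdist x y).
    exact: ltr_add_invr.
  move: hN; rewrite add0r lt_min => /andP[Ne Nr].
  exists N => // n /= Nn; have dn := deln _ _ Nn.
  rewrite /h indicE mem_set ?mulr1; last first.
    rewrite ballEmdist/= ltrBrDr -ltrBrDl.
    exact: le_lt_trans Nr.
  rewrite ger0_norm; last by rewrite subr_ge0 ge_max w0/= gerBl ltW.
  rewrite lerBlDr -lerBlDl le_max; apply/orP; right.
  by rewrite lerB// (le_trans dn)// ltW.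
have psiE : psi x = limn (fun n => \int[mu]_y (h n y)%:E)%E.
  rewrite -monotone_convergence//.
  - rewrite /psi [LHS]integral_mkcond; apply: eq_integral => y _.
    have cE : (h n y)%:E @[n --> \oo] --> (w x y * \1_(ball x r) y)%:E.
      by apply: cvg_EFin; [exact: nearW|exact: hcv].
    rewrite (cvg_lim _ cE)// patchE indicE.
    by case: ifPn => yB; rewrite ?mulr1 ?mulr0.
  - by move=> n; exact/measurable_EFinP.
  - by move=> n y _; rewrite lee_fin.
  - by move=> y _ m n mn; rewrite lee_fin hnd.
have [n cn] : exists n, (c%:E < \int[mu]_y (h n y)%:E)%E.
  apply: contrapT => /forallNP hn; move: cx.
  rewrite -/(psi x) psiE ltNge => /negP; apply; apply: lime_le.
    apply: ereal_nondecreasing_is_cvgn => m n mn; apply: ge0_le_integral => //.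
    - by move=> y _; rewrite lee_fin.
    - exact/measurable_EFinP.
    - exact/measurable_EFinP.
    - by move=> y _; rewrite lee_fin hnd.
  by apply: nearW => n; rewrite leNgt; apply/negP.
apply/nbhs_ballP; exists (del n) => //= x'; rewrite ballEmdist/= => xx'.
apply: (lt_le_trans cn); rewrite /psi [leRHS]integral_mkcond.
have mB : measurable (ball x' r) by exact: measurable_mball.
apply: ge0_le_integral => //.
- by move=> y _; rewrite lee_fin.
- exact/measurable_EFinP.
- apply/(measurable_restrictT _ mB).1/measurable_EFinP; exact: measurable_funTS.
- move=> y _; rewrite patchE /h indicE.
  case: (boolP (y \in (ball x (r - del n) : set T))) => [/set_mem yn|_]; last first.
    by rewrite mulr0; case: ifP => //; rewrite lee_fin.
  have yB : ball x' r y.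
    apply: sub_ball yn; rewrite metric_sym -lerBrDr opprB addrCA subrr addr0.
    exact: ltW.
  rewrite mem_set// mulr1 lee_fin ge_max w0/= lerBlDr.
  by rewrite (le_trans (w_lip x x' y))// lerD2l ltW.
Qed.

End lower_semicontinuity.

(** * The cutoff function of a ball of radius 1 *)
Section cutoff.
Context {R : realType} {d : measure_display} {T : metricMeasurableType R d}.
Variable mu : {measure set T -> \bar R}.
Hypothesis T_borel : borel_space T.
Hypothesis mu_doubling : doubling_measure mu.
Hypothesis mu_infinite : mu setT = +oo%E.
Variable x0 : T.

Definition cutoff (y : T) : R := Num.max 0 (1 - mdist x0 y).
Local Notation f := cutoff.

Lemma cutoff_ge0 y : 0 <= f y. Proof. by rewrite le_max lexx. Qed.

Lemma cutoff_le1 y : f y <= 1.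
Proof. by rewrite ge_max ler01 gerBl mdist_ge0. Qed.

Lemma cutoff_lip x y : `|f x - f y| <= mdist x y.
Proof.
have h a b : f a - f b <= mdist a b.
  rewrite lerBlDr ge_max addr_ge0 ?mdist_ge0 ?cutoff_ge0//=.
  rewrite lerBlDr -addrA (@le_trans _ _ (mdist a b + (1 - mdist x0 b + mdist x0 a)))//.
    by have := metric_triangle x0 a b; lra.
  by rewrite lerD2l lerD2r le_max lexx orbT.
rewrite ler_norml h andbT lerNl opprB metric_sym; exact: h.
Qed.

Lemma measurable_cutoff : measurable_fun setT f.
Proof.
apply: measurable_maxr => //; apply/measurable_EFinP.
apply: measurable_lsc => // c.
have -> : [set x | (c%:E < (EFin \o (fun y => (1 - mdist x0 y)%R)) x)%E] = ball x0 (1 - c).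
  by apply/seteqP; split => x; rewrite ballEmdist/= lte_fin; lra.
exact: open_ball_metric.
Qed.

Lemma cutoff_pow1 : pow_abs 1 f = f.
Proof. by apply/funext => x; rewrite /pow_abs powRr1// ger0_norm// cutoff_ge0. Qed.

(** Membership of the gradient in L^oo includes its measurability, without which
    the modulus would be infinite. *)
Lemma measurable_nabla_cutoff r : 0 < r -> measurable_fun setT (nabla mu 1 r f).
Proof.
move=> r0; rewrite /nabla invr1.
have mm : measurable_fun setT (fun x => mu (ball x r)).
  have := @measurable_ball_integral _ _ _ mu T_borel (fun _ _ => 1) _ _ _ r.
  have E : (fun x => \int[mu]_(y in ball x r) 1%:E)%E = (fun x => mu (ball x r)).
    apply/funext => x; rewrite integral_cst ?mul1e//; exact: measurable_mball.
  rewrite E; apply => // x x' y; by rewrite lerDl mdist_ge0.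
have mi : measurable_fun setT (fun x => (\int[mu]_(y in ball x r) (`|f x - f y| `^ 1)%:E)%E).
  apply: (@measurable_ball_integral _ _ _ mu T_borel (fun x y => `|f x - f y| `^ 1)).
  - by move=> x y; rewrite powR_ge0.
  - move=> x; apply: (measurableT_comp (measurable_powR _)) => //.
    apply: measurableT_comp => //; apply: measurable_funB => //.
    exact: measurable_cutoff.
  - move=> x x' y; rewrite !powRr1//.
    have := cutoff_lip x x'; have := ler_distD (f x') (f x) (f y); lra.
apply: (measurableT_comp (measurable_powR _)) => //.
apply: measurable_funM; last exact: measurableT_comp.
have -> : (fun x => (fine (mu (ball x r)))^-1) = (fun x => (fine (mu (ball x r))) `^ (-1)).
  by apply/funext => x; rewrite powR_inv1// fine_ge0.
apply: (measurableT_comp (measurable_powR _)) => //.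
exact: measurableT_comp.
Qed.

(** The cutoff is 1-Lipschitz with values in [0, 1]. *)
Lemma nabla_cutoff_le r x : 0 < r ->
  0 <= nabla mu 1 r f x <= Num.min 1 r.
Proof.
move=> r0; rewrite /nabla powR_ge0/=.
have mB : measurable (ball x r) by exact: measurable_mball.
have m0 : 0 < fine (mu (ball x r)) by rewrite fine_gt0// mu_ball_gt0//= mu_ball_lty.
have I0 : (0 <= \int[mu]_(y in ball x r) (`|f x - f y| `^ 1)%:E)%E.
  by apply: integral_ge0 => y _; rewrite lee_fin powR_ge0.
have hI : (\int[mu]_(y in ball x r) (`|f x - f y| `^ 1)%:E
    <= (Num.min 1 r * fine (mu (ball x r)))%:E)%E.
  rewrite EFinM fineK ?mu_ball_fin// -integral_cst//.
  apply: ge0_le_integral => //.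
  - apply/measurable_EFinP; apply: measurable_funTS.
    apply: (measurableT_comp (measurable_powR _)) => //.
    apply: measurableT_comp => //; apply: measurable_funB => //.
    exact: measurable_cutoff.
  - move=> y; rewrite ballEmdist/= => xy; rewrite lee_fin powRr1// le_min.
    rewrite (le_trans (cutoff_lip x y) (ltW xy)) andbT.
    have := cutoff_ge0 x; have := cutoff_ge0 y; have := cutoff_le1 x; have := cutoff_le1 y.
    by rewrite ler_norml; lra.
rewrite invr1 powRr1; last by rewrite mulr_ge0 ?invr_ge0 ?(ltW m0)// fine_ge0.
rewrite ler_pdivrMl// mulrC -lee_fin /Rintegral fineK//.
by rewrite ge0_fin_numE// (le_lt_trans hI)// ltry.
Qed.

Lemma modulus_cutoff r : 0 < r ->
  (modulus (linfty mu) 1 f r <= (Num.min 1 r)%:E)%E.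
Proof.
move=> r0.
have E : pow_abs 1 (nabla mu 1 r f) = nabla mu 1 r f.
  apply/funext => x; have /andP[n0 _] := nabla_cutoff_le x r0.
  by rewrite /pow_abs powRr1// ger0_norm.
have m0 : 0 <= Num.min 1 r by rewrite le_min ler01 ltW.
have [XN hN] : linf_car mu (nabla mu 1 r f) /\ linf_norm mu (nabla mu 1 r f) <= Num.min 1 r.
  apply: linf_le => //; first exact: measurable_nabla_cutoff.
  by apply: aeW => x; have /andP[n0 n1] := nabla_cutoff_le x r0; rewrite ger0_norm.
rewrite /modulus convex_norm_car E// invr1 lee_fin powRr1//.
exact: linf_norm_ge0.
Qed.

Lemma besov_cutoff s : 0 < s < 1 ->
  (besov_seminorm (linfty mu) 1 s +oo f <= 1)%E.
Proof.
move=> /andP[s0 s1]; apply: ge_ereal_sup => _ [r /= + <-]; rewrite in_itv/= andbT => r0.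
apply: (@le_trans _ _ ((r `^ (- s))%:E * (Num.min 1 r)%:E)%E).
  by apply: lee_wpmul2l; [rewrite lee_fin powR_ge0|exact: modulus_cutoff].
rewrite -EFinM lee_fin powRN mulrC ler_pdivrMr ?powR_gt0// mul1r.
have [r1|r1] := leP 1 r.
  by rewrite -(powRr0 r); apply: ler_powR => //; exact: ltW.
by apply: ger1_powR; [rewrite r0 ltW|exact: ltW].
Qed.

Lemma cutoff_Linfty : ('N[mu]_+oo[EFin \o f] <= 1)%E.
Proof.
rewrite unlock /= mu_infinite ltry; apply/ess_supP; apply: aeW => x /=.
by rewrite lee_fin ger0_norm ?cutoff_ge0// cutoff_le1.
Qed.

Lemma cutoff_decomp : sum_decomp mu 1 f (cst 0, f).
Proof.
split => //=.
- exact: measurable_cutoff.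
- by rewrite /finite_norm (_ : EFin \o cst 0 = cst 0%E)// Lnorm0// ltry.
- exact: le_lt_trans cutoff_Linfty (ltry _).
- by move=> x; rewrite add0r.
Qed.

Lemma sum_norm_cutoff : (sum_norm mu 1 f <= 1)%E.
Proof.
apply: (@le_trans _ _ ('N[mu]_1[EFin \o (cst 0%R : T -> R)] + 'N[mu]_+oo[EFin \o f])%E).
  by apply: ereal_inf_lbound; exists (cst 0, f) => //; exact: cutoff_decomp.
rewrite (_ : EFin \o (cst 0%R : T -> R) = cst 0%E)// Lnorm0// add0e.
exact: cutoff_Linfty.
Qed.

(** The cutoff vanishes outside the unit ball, so f*(m) = 0, and is at least 1/2
    on the ball of radius 1/2, whose measure is at least m / C by doubling. *)
Lemma oscill_cutoff m : mu (ball x0 1) = m%:E -> 0 < m ->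
  ((2 * doubling_constant mu)^-1%:E <= oscill mu f m)%E.
Proof.
move=> mE m0.
have D1 := doubling_constant_ge1 mu_doubling.
have D0 := lt_le_trans ltr01 D1.
have rf : rearr mu f m = 0%E.
  apply/eqP; rewrite eq_le rearr_ge0 andbT; apply: rearr_le => //.
  rewrite -mE; apply: le_measure; rewrite ?inE.
  - by apply: measurable_level; exact: measurable_cutoff.
  - exact: measurable_mball.
  - move=> x /=; rewrite ger0_norm ?cutoff_ge0// lt_max ltxx/= ballEmdist/=.
    by rewrite subr_gt0.
rewrite /oscill rf sube0 /rearr_avg.
have h0 : 0 < 2^-1 :> R by [].
pose m' := fine (mu (ball x0 2^-1)).
have m'E : mu (ball x0 2^-1) = m'%:E by rewrite fineK// mu_ball_fin.
have m'0 : 0 < m' by rewrite fine_gt0// mu_ball_gt0//= mu_ball_lty.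
have mm' : m' <= m.
  by rewrite -lee_fin -mE -m'E; apply: le_measure_ballr => //; lra.
have mDm' : m <= doubling_constant mu * m'.
  rewrite -lee_fin EFinM -mE -m'E.
  have := doubling_with_constant mu_doubling x0 h0.
  by rewrite mulfV.
rewrite -[leRHS]/(_ * _)%E -lee_pdivrMl ?invr_gt0// invrK -EFinM.
apply: (@le_trans _ _ (2^-1 * m')%:E).
  rewrite lee_fin invfM mulrC -mulrA ler_pM2l// ler_pdivrMl//.
apply: (@le_trans _ _ (\int[@lebesgue_measure R]_(s in `]0%R, m'[) rearr mu f s)%E).
  have <- : (\int[@lebesgue_measure R]_(s in `]0%R, m'[) cst (2^-1)%:E s = (2^-1 * m')%:E)%E.
    by rewrite integral_cst//= lebesgue_measure_itv/= lte_fin m'0 oppr0 adde0 -EFinM.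
  apply: ge0_le_integral => //.
    by move=> s _; rewrite /= lee_fin ltW.
    exact: measurable_rearr.
  move=> s /=; rewrite in_itv/= => /andP[_ sm'].
  apply: le_ereal_inf_tmp => _ [u [u0 hu] <-]; rewrite lee_fin leNgt; apply/negP => u2.
  have : (m'%:E <= s%:E)%E.
    apply: (le_trans _ hu); rewrite -m'E; apply: le_measure; rewrite ?inE.
    - exact: measurable_mball.
    - by apply: measurable_level; exact: measurable_cutoff.
    - move=> y; rewrite ballEmdist/= => xy.
      by rewrite ger0_norm ?cutoff_ge0// lt_max; apply/orP; right; lra.
  by rewrite lee_fin leNgt sm'.
apply: ge0_subset_integral => //.
- exact: measurable_rearr.
- by move=> s _; exact: rearr_ge0.
- by move=> s /=; rewrite !in_itv/= => /andP[-> /lt_le_trans]; apply.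
Qed.

End cutoff.

(** * The estimate implies noncollapsing *)
Section estimate_to_noncollapsing.
Context {R : realType} {d : measure_display} {T : metricMeasurableType R d}.
Variable mu : {measure set T -> \bar R}.
Hypothesis T_borel : borel_space T.
Hypothesis mu_doubling : doubling_measure mu.
Hypothesis mu_infinite : mu setT = +oo%E.
Hypothesis mu_atomless : forall x : T, mu [set x] = 0%E.
Local Notation D := (doubling_constant mu).
Local Notation Q := (upper_dim mu).

(** Any single s in (0, 1) will do.  At t = m = mu(B(x0, 1)) < 1 the estimate for
    the cutoff reads (2C0)^-1 m^(-s/Q) <= 2C with C0 the doubling constant. *)
Lemma estimate_noncollapsing (s C : R) : 0 < s < 1 -> 0 < C ->
  (forall X : qri_space mu, is_ri X -> normalized X ->
   forall f : T -> R, sum_space mu 1 f ->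
     (oscill_norm X 1 s +oo f
      <= C%:E * (besov_seminorm X 1 s +oo f + sum_norm mu 1 f))%E) ->
  noncollapsing mu.
Proof.
move=> s01 C0 est; have /andP[s0 s1] := s01.
have mu_div : divisible mu by exact: doubling_divisible.
have Q0 := upper_dim_gt0 T_borel mu_doubling mu_infinite.
have D0 : 0 < D := lt_le_trans ltr01 (doubling_constant_ge1 mu_doubling).
pose p := s / Q; have p0 : 0 < p by rewrite divr_gt0.
pose b := Num.min 1 ((4 * D * C)^-1 `^ p^-1).
have b0 : 0 < b by rewrite lt_min ltr01 powR_gt0// invr_gt0 !mulr_gt0.
have lb x0 : (b%:E <= mu (ball x0 1))%E.
  pose m := fine (mu (ball x0 1)).
  have mE : mu (ball x0 1) = m%:E by rewrite fineK// mu_ball_fin.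
  have m0 : 0 < m by rewrite fine_gt0// mu_ball_gt0//= mu_ball_lty.
  rewrite mE lee_fin ge_min.
  have [//|m1] := leP 1 m.
  have fs : sum_space mu 1 (cutoff x0).
    by exists (cst 0, cutoff x0); exact: cutoff_decomp.
  have := est _ (@linfty_ri _ _ _ mu) (linfty_normalized mu_div mu_infinite) _ fs.
  set L := oscill_norm _ _ _ _ _ => hL.
  have : (((2 * D)^-1 * (m `^ p)^-1)%:E <= L)%E.
    have : (oscill mu (pow_abs 1 (cutoff x0)) m `^ 1^-1
             * fundamental mu (convex_norm (linfty mu) 1) m
             * ((m `^ (s / Q))^-1)%:E <= L)%E.
      by apply: ereal_sup_ubound; exists m => //=; rewrite in_itv/= m0.
    apply: le_trans; rewrite (linfty_fundamental mu_div mu_infinite ltr01 m0) mule1.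
    rewrite invr1 cutoff_pow1.
    have ho := oscill_cutoff T_borel mu_doubling mE m0.
    rewrite poweRe1; last by apply: (le_trans _ ho); rewrite lee_fin invr_ge0 mulr_ge0 ?ltW.
    by rewrite EFinM lee_wpmul2r// lee_fin invr_ge0 powR_ge0.
  move=> /le_trans/(_ hL) h.
  have {h} : (2 * D)^-1 * (m `^ p)^-1 <= C * 2.
    rewrite -lee_fin; apply: (le_trans h); rewrite EFinM lee_wpmul2l ?lee_fin ?(ltW C0)//.
    apply: (le_trans (leeD (besov_cutoff T_borel mu_doubling x0 s01)
                           (sum_norm_cutoff T_borel mu_infinite x0))).
    by rewrite -EFinD.
  rewrite -invfM -[leLHS]mul1r ler_pdivrMr ?mulr_gt0 ?powR_gt0// => h.
  apply/orP; right.
  have -> : m = (m `^ p) `^ p^-1 by rewrite powR_Kinv// ltW.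
  apply: ge0_ler_powR; rewrite ?nnegrE ?invr_ge0 ?powR_ge0 ?(ltW p0)//.
    by rewrite !mulr_ge0 ?ltW.
  by rewrite -[leLHS]mul1r ler_pdivrMr ?mulr_gt0//; lra.
have [x _] := infinite_point mu_infinite.
pose i := ereal_inf [set mu (ball x 1) | x in [set: T]].
have ib : (b%:E <= i)%E by apply: le_ereal_inf_tmp => _ [y _ <-].
have ifin : i \is a fin_num.
  rewrite ge0_fin_numE; last by apply: (le_trans _ ib); rewrite lee_fin ltW.
  apply: (@le_lt_trans _ _ (mu (ball x 1))); last exact: mu_ball_lty.
  by apply: ereal_inf_lbound; exists x.
exists (fine i); last by rewrite fineK.
by rewrite -lte_fin fineK// (lt_le_trans _ ib)// lte_fin.
Qed.

End estimate_to_noncollapsing.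

Theorem theorem4 (R : realType) (d : measure_display)
    (T : metricMeasurableType R d) (mu : {measure set T -> \bar R})
    (T_borel : borel_space T)
    (mu_doubling : doubling_measure mu)
    (mu_infinite : mu [set: T] = +oo%E)
    (mu_atomless : forall x : T, mu [set x] = 0%E) :
  noncollapsing mu
  <->
  forall (alpha : R) (q : \bar R), 0 < alpha <= 1 -> (0 < q)%E ->
    exists2 C : R, 0 < C &
      forall s : R, 0 < s < 1 ->
      forall X : qri_space mu, is_ri X -> normalized X ->
      forall f : T -> R, sum_space mu alpha f ->
        (oscill_norm X alpha s q f
         <= C%:E * (besov_seminorm X alpha s q f + sum_norm mu alpha f))%E.
Proof.
split=> [ncol alpha q a01 q0|est].
  exact: noncollapsing_estimate.
have a01 : 0 < (1 : R) <= 1 by rewrite ltr01 lexx.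
have [C C0 hC] := est 1 +oo%E a01 (ltry _).
have s01 : 0 < (2^-1 : R) < 1 by lra.
exact: (estimate_noncollapsing T_borel mu_doubling mu_infinite mu_atomless s01 C0 (hC _ s01)).
Qed.
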